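(* Let $p,q:\mathbb{R}^2\to\mathbb{R}$ be two finite linear-like submersions. Then $p$ and $q$ are o-topologically equivalent if and only if either $B(p)=B(q)=\emptyset$, or both of the following conditions hold: (a) $\mathscr{F}(p)$ and $\mathscr{F}(q)$ are o-topologically equivalent. (b) There exist an o-equivalence homeomorphism $h:\mathbb{R}^2\to\mathbb{R}^2$ between $\mathscr{F}(p)$ and $\mathscr{F}(q)$ and an increasing bijection $\sigma:B(p)\to B(q)$ such that $$p^{-1}(\sigma^{-1}(c))=h^{-1}(q^{-1}(c))\quad\text{for each } c\in B(q).$$ If $B(p)$ is a singleton, there further exist (for this same $h$ and $\sigma$) a number $m\in\mathbb{R}\setminus B(p)$ and an extension of $\sigma$ to an increasing bijection $\overline{\sigma}:B(p)\cup\{m\}\to B(q)\cup\{\overline{\sigma}(m)\}$ such that $p^{-1}(m)=h^{-1}(q^{-1}(\overline{\sigma}(m)))$.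
   Context: A linear-like function is a function $p:\mathbb{R}^2\to\mathbb{R}$ of the form $p(x,y)=r(x)+s(x)y$, where $r,s:\mathbb{R}\to\mathbb{R}$ are $C^\infty$. It is a submersion if its gradient vanishes nowhere. A finite linear-like submersion is a linear-like submersion for which $\{x\in\mathbb{R}: s(x)=0\}$ is finite (possibly empty). For a $C^\infty$ submersion $f:\mathbb{R}^2\to\mathbb{R}$, $\mathscr{F}(f)$ denotes the regular foliation of $\mathbb{R}^2$ whose leaves are the connected components of the level sets of $f$. Two functions $f,g:\mathbb{R}^2\to\mathbb{R}$ are o-topologically equivalent if there exist orientation preserving homeomorphisms $h:\mathbb{R}^2\to\mathbb{R}^2$ and $\ell:\mathbb{R}\to\mathbb{R}$ (so $\ell$ is increasing) such that $\ell\circ f=g\circ h$. Two regular foliations $\mathscr{F},\mathscr{G}$ of $\mathbb{R}^2$ are o-topologically equivalent if there is an orientation preserving homeomorphism $h:\mathbb{R}^2\to\mathbb{R}^2$ carrying each leaf of $\mathscr{F}$ onto a leaf of $\mathscr{G}$; such $h$ is called an o-equivalence homeomorphism between $\mathscr{F}$ and $\mathscr{G}$. Bifurcation set: a continuous map $p:X\to Y$ between topological spaces is a trivial fibration if there are a topological space $F$ and a homeomorphism $\varphi:F\times Y\to X$ such that $p\circ\varphi$ is the projection onto $Y$. It is a locally trivial fibration at $y\in Y$ if there is a neighbourhood $U$ of $y$ such that the restriction $p:p^{-1}(U)\to U$ is a trivial fibration. $B(p)$ is the set of $y\in Y$ at which $p$ is not a locally trivial fibration. *)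

(* Defs.v *)
From HB Require Import structures.
From mathcomp Require Import all_boot all_order all_algebra.
From mathcomp Require Import all_classical all_reals all_analysis.

Set Implicit Arguments.
Unset Strict Implicit.
Unset Printing Implicit Defensive.

Import Order.TTheory GRing.Theory Num.Theory.
Import numFieldNormedType.Exports.

Local Open Scope classical_set_scope.
Local Open Scope ring_scope.

Definition homeomorphism (X Y : topologicalType) (h : X -> Y) : Prop :=
  exists g : Y -> X,
    [/\ continuous h, continuous g, cancel h g & cancel g h].

(* Locally trivial fibrations. Subsets, seen as types, carry the induced
   topology. *)

Definition trivial_fibration (X Y : topologicalType) (p : X -> Y) : Prop :=
  exists (F : topologicalType) (phi : F * Y -> X),
    homeomorphism phi /\ forall z, p (phi z) = z.2.

Definition restrict_over (X Y : topologicalType) (p : X -> Y) (U : set Y)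
    (x : p @^-1` U) : U :=
  exist (fun y => y \in U) (p (val x)) (mem_set (set_valP x)).

Definition locally_trivial_at (X Y : topologicalType) (p : X -> Y) (y : Y) :
    Prop :=
  exists U : set Y, nbhs y U /\ trivial_fibration (@restrict_over X Y p U).

Definition bifurcation_set (X Y : topologicalType) (p : X -> Y) : set Y :=
  [set y | ~ locally_trivial_at p y].

Section Plane.
Context {R : realType}.
Local Notation plane := (R * R)%type.

(* [n] is the winding number about [c] of the loop [gamma], given as a
   2pi-periodic map: [theta] is a continuous determination of the angle. *)
Definition winding_number (gamma : R -> plane) (c : plane) (n : int) : Prop :=
  exists rho theta : R -> R,
    [/\ continuous rho, continuous theta, forall t, 0 < rho t,
        forall t, gamma t = (c.1 + rho t * cos (theta t),
                             c.2 + rho t * sin (theta t))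
      & theta (2 * pi) - theta 0 = 2 * pi * n%:~R].

Definition circle (z : plane) (e : R) (t : R) : plane :=
  (z.1 + e * cos t, z.2 + e * sin t).

(* Local degree 1 at each point: [h] maps every positively oriented circle
   around [z] to a loop winding once, positively, around [h z]. Meaningful for
   continuous injective [h]. *)
Definition orientation_preserving (h : plane -> plane) : Prop :=
  forall (z : plane) (e : R), 0 < e ->
    winding_number (h \o circle z e) (h z) 1.

Definition o_homeo (h : plane -> plane) : Prop :=
  homeomorphism h /\ orientation_preserving h.

Definition o_homeo_line (l : R -> R) : Prop :=
  homeomorphism l /\ {homo l : x y / x < y}.

Definition o_top_equivalent (f g : plane -> R) : Prop :=
  exists (h : plane -> plane) (l : R -> R),
    [/\ o_homeo h, o_homeo_line l & l \o f = g \o h].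

(* A foliation is given by its set of leaves. *)
Definition level_foliation (f : plane -> R) : set (set plane) :=
  [set L | exists z, L = connected_component (f @^-1` [set f z]) z].

Definition o_equivalence_homeo (F G : set (set plane)) (h : plane -> plane) :
    Prop :=
  o_homeo h /\ forall L, F L -> G (h @` L).

Definition foliation_o_equivalent (F G : set (set plane)) : Prop :=
  exists h, o_equivalence_homeo F G h.

Definition smooth (r : R -> R) : Prop :=
  forall (n : nat) (x : R), derivable (derive1n n r) x 1.

Definition gradient (f : plane -> R) (z : plane) : plane :=
  ('D_((1, 0) : plane) f z, 'D_((0, 1) : plane) f z).

(* The functions [r] and [s] are determined by [p]. *)
Definition finite_linear_like_submersion (p : plane -> R) : Prop :=
  (exists r s : R -> R,
    [/\ smooth r, smooth s, finite_set [set x | s x = 0]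
      & forall x y, p (x, y) = r x + s x * y])
  /\ forall z, gradient p z != 0.

(* Increasing bijections between sets of reals; only the values of [sigma] on
   [A] matter. *)
Definition increasing_bij (A B : set R) (sigma : R -> R) : Prop :=
  set_bij A B sigma /\
  forall x y, A x -> A y -> x < y -> sigma x < sigma y.

End Plane.

(* Main.v *)
Require Import Defs.
From mathcomp Require Import all_boot all_order all_algebra.
From mathcomp Require Import all_classical all_reals all_analysis.
From mathcomp Require Import ring lra.
Set Implicit Arguments.
Unset Strict Implicit.
Unset Printing Implicit Defensive.
Import Order.TTheory GRing.Theory Num.Theory.
Import numFieldNormedType.Exports.
Local Open Scope classical_set_scope.
Local Open Scope ring_scope.

(* At a zero [a] of [s] the submersion condition forces [s' a = 0] and
   [r' a <> 0]: the line [x = a] is a leaf, crossed transversally, and over each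
   interval without zeros every level of [p] is exactly one leaf, the graph of
   [(c - r) / s]. The value [r a] is a bifurcation value.

   Given [h] carrying leaves to leaves, [q \o h = lam_m \o p] on the strip with
   base point [m], for a continuous [lam_m : R -> R]. Since [q] has no local
   extremum, neither has [lam_m], which is thus strictly monotone, and condition
   (b) makes it increasing and equal to [sigma] on [B(p)]. It is onto: if its
   values stayed below [d], the leaf of [q] of level [d] would be sent by the
   inverse of [h] to infinitely high levels of [p]. With [l := lam_m0] for a fixed
   [m0], the maps [mu_m := lam_m^-1 \o l] fix [B(p)] pointwise, so it suffices to
   find a homeomorphism [G] of the plane, isotopic to the identity, fixing the
   vertical leaves and with [p \o G = mu_m \o p] on the strip of [m]: then
   [q \o (h \o G) = l \o p].

   [G] matches points of equal leaf coordinate. That coordinate is built from the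
   running infimum of [atan y] along the leaf, starting at the vertical leaf that
   bounds the strip: near this vertical leaf it is close to [atan y], which makes
   [G] extend continuously by the identity. *)

(** * Winding numbers and isotopies *)

Section RealFacts.
Context {R : realType}.
Implicit Types (x y : R) (z : R * R).

(** The obstacle is to extend [G] across the vertical leaves. Towards [x = a] a graph leaf goes up
    to infinity if its level lies on one side of [r a], and down to infinity otherwise. Leaves can
    thus be matched only if [mu_m] keeps every level on its side of each [r a], which is what (b)
    secures. The height itself is no coordinate, since a leaf may oscillate: its running infimum is
    monotone, [atan] keeps it bounded, a summand [x - a] makes it strict, and division by the value
    at the base point lets the two halves of a strip be glued. If [B(p)] has one point, monotonicity
    of [sigma] says nothing about the direction of the maps [lam_m]; the additional level [m] fixes
    it. Without vertical leaves a level-preserving map is written down directly, with a half turn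
    where orientation requires it. Since orientation is defined by winding numbers, it is carried
    along isotopies: levels move on straight segments from the identity to [mu_m], so the leaf shift
    has to be continuous in time and point jointly. *)

Lemma near_realP x (P : R -> Prop) :
  (\forall y \near x, P y) <->
  exists2 e : R, 0 < e & forall y, `|y - x| < e -> P y.
Proof.
split=> [/nbhs_ballP[e /= e0 eP]|[e e0 eP]].
  by exists e => // y yx; apply: eP; rewrite /ball/= distrC.
by apply/nbhs_ballP; exists e => //= y; rewrite /ball/= distrC; exact: eP.
Qed.

Lemma near_planeP z (P : R * R -> Prop) :
  (\forall w \near z, P w) <->
  exists2 e : R, 0 < e &
    forall x y, `|x - z.1| < e -> `|y - z.2| < e -> P (x, y).
Proof.
split=> [/nbhs_ballP[e /= e0 eP]|[e e0 eP]].
  exists e => // x y xz yz; apply: eP.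
  by rewrite /ball/= /prod_ball/= /ball/= !(distrC z.1, distrC z.2).
apply/nbhs_ballP; exists e => //= -[x y]; rewrite /ball/= /prod_ball/= /ball/=.
by rewrite (distrC z.1) (distrC z.2) => -[]; exact: eP.
Qed.

(** The truth set of [P] in [I] is relatively open and closed in a connected set. This serves both
    for the time of an isotopy and for the abscissa along a graph leaf. *)
Lemma locally_constant_interval (I : set R) (P : R -> Prop) :
  is_interval I ->
  (forall x, I x -> \forall y \near x, I y -> (P x <-> P y)) ->
  forall x y, I x -> I y -> P x -> P y.
Proof.
move=> /connected_intervalP cI lP x y Ix Iy Px.
have -> : P y = (I `&` P) y by rewrite /setI/= propeqE; split=> // -[].
suff -> : I `&` P = I by [].
apply: cI; first by exists x.
- exists (interior [set t | I t -> P t]); first exact: open_interior.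
  apply/seteqP; split=> t [It] => [Pt|/interior_subset]; last by split; auto.
  split=> //; by apply: filterS (lP t It) => u h Iu; apply/(h Iu).
- exists (~` interior [set t | I t -> ~ P t]).
    exact/open_closedC/open_interior.
  apply/seteqP; split=> t [It] Pt; split=> //.
    by move=> /interior_subset /(_ It).
  apply: contrapT => nPt; apply: Pt.
  by apply: filterS (lP t It) => u h Iu Pu; apply/nPt/(h Iu).
Qed.

Lemma is_intervalT : is_interval [set: R].
Proof. by []. Qed.

End RealFacts.

Section PairContinuity.
Context {S T U V : topologicalType}.
Implicit Type s : S.

Lemma for_fst (f : S -> T * U) s :
  {for s, continuous f} -> {for s, continuous (fun x => (f x).1)}.
Proof. by move=> cf; apply: (continuous_comp cf); exact: cvg_fst. Qed.

Lemma for_snd (f : S -> T * U) s :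
  {for s, continuous f} -> {for s, continuous (fun x => (f x).2)}.
Proof. by move=> cf; apply: (continuous_comp cf); exact: cvg_snd. Qed.

Lemma for_pair (f : S -> T) (g : S -> U) s :
  {for s, continuous f} -> {for s, continuous g} ->
  {for s, continuous (fun x => (f x, g x))}.
Proof. by move=> cf cg; apply: cvg_pair; [exact: cf|exact: cg]. Qed.

Lemma for_comp2 (f : S -> T) (g : S -> U) (k : T * U -> V) s :
  {for s, continuous f} -> {for s, continuous g} ->
  {for (f s, g s), continuous k} -> {for s, continuous (fun x => k (f x, g x))}.
Proof.
by move=> cf cg ck; apply: (@continuous_comp _ _ _ (fun x => (f x, g x)) k);
  [exact: for_pair|].
Qed.

End PairContinuity.

Section Winding.
Context {R : realType}.
Local Notation plane := (R * R)%type.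
Implicit Types (z w : plane) (g : R -> plane) (h : plane -> plane).

Definition dot (v w : plane) : R := v.1 * w.1 + v.2 * w.2.

(* Two loops making an acute angle at all times wind equally often: the
   difference of the angles is [atan (b / a)]. *)
Lemma winding_number_acute (g1 g2 : R -> plane) (c1 c2 : plane) (n : int) :
  continuous g1 -> g1 (2 * pi) = g1 0 -> g2 (2 * pi) = g2 0 ->
  (forall t, 0 < dot (g1 t - c1) (g2 t - c2)) ->
  winding_number g2 c2 n -> winding_number g1 c1 n.
Proof.
move=> cg1 per1 per2 g12 [rho [theta [crho ctheta rho0 g2E thE]]].
pose v t := g1 t - c1.
(* [a] and [b] are the components of [v] in the frame turned by [theta]. The acute angle means
   [a > 0], so [atan (b / a)] is a continuous correction of the angle. *)
pose a t := (v t).1 * cos (theta t) + (v t).2 * sin (theta t).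
pose b t := (v t).2 * cos (theta t) - (v t).1 * sin (theta t).
have a0 t : 0 < a t.
  have := g12 t; rewrite /dot g2E /= !(addrC _ (rho t * _)) !addrK.
  rewrite mulrCA (mulrCA _ (rho t)) -mulrDr pmulr_rgt0 //.
have cv1 : continuous (fun t => (v t).1).
  by move=> t; apply: cvgB; [exact: for_fst (cg1 t)|exact: cvg_cst].
have cv2 : continuous (fun t => (v t).2).
  by move=> t; apply: cvgB; [exact: for_snd (cg1 t)|exact: cvg_cst].
have ccos : continuous (fun t => cos (theta t)).
  by move=> t; apply: (continuous_comp (ctheta t)); exact: continuous_cos.
have csin : continuous (fun t => sin (theta t)).
  by move=> t; apply: (continuous_comp (ctheta t)); exact: continuous_sin.
have ca : continuous a by move=> t; apply: cvgD; apply: cvgM;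
  [exact: cv1|exact: ccos|exact: cv2|exact: csin].
have cb : continuous b by move=> t; apply: cvgB; apply: cvgM;
  [exact: cv2|exact: ccos|exact: cv1|exact: csin].
pose phi t := atan (b t / a t).
have cphi : continuous phi.
  move=> t; apply: (@continuous_comp _ _ _ (fun t => b t / a t) atan);
    last exact: continuous_atan.
  apply: cvgM; first exact: cb.
  by apply: cvgV; [rewrite gt_eqF|exact: ca].
have cosphi0 t : 0 < cos (phi t).
  by apply: cos_gt0_pihalf; rewrite atan_gtNpi2 atan_ltpi2.
have sinphi t : sin (phi t) = (b t / a t) * cos (phi t).
  by have := atanK (b t / a t); rewrite /tan -/(phi t) => <-; rewrite divfK // gt_eqF.
exists (fun t => a t / cos (phi t)), (fun t => theta t + phi t).
split.
- move=> t; apply: cvgM; first exact: ca.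
  apply: cvgV; first by rewrite gt_eqF.
  by apply: (continuous_comp (cphi t)); exact: continuous_cos.
- by move=> t; apply: cvgD; [exact: ctheta|exact: cphi].
- by move=> t; rewrite divr_gt0.
- move=> t; have cs := cos2Dsin2 (theta t).
  have ha : a t != 0 by rewrite gt_eqF.
  have hc : cos (phi t) != 0 by rewrite gt_eqF.
  have E1 : a t / cos (phi t) * cos (theta t + phi t) = (v t).1.
    rewrite cosD sinphi; transitivity (a t * cos (theta t) - b t * sin (theta t)).
      by field; rewrite ha hc.
    rewrite /a /b; transitivity ((v t).1 * (cos (theta t) ^+ 2 + sin (theta t) ^+ 2)).
      by ring.
    by rewrite cs mulr1.
  have E2 : a t / cos (phi t) * sin (theta t + phi t) = (v t).2.
    rewrite sinD sinphi; transitivity (a t * sin (theta t) + b t * cos (theta t)).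
      by field; rewrite ha hc.
    rewrite /a /b; transitivity ((v t).2 * (cos (theta t) ^+ 2 + sin (theta t) ^+ 2)).
      by ring.
    by rewrite cs mulr1.
  rewrite E1 E2 /v /=; case: (g1 t) => u1 u2 /=; congr pair; ring.
(* The second loop closes up, so [cos (theta t)] and [sin (theta t)] agree at both ends, hence so
   does the correction [phi]. *)
- suff -> : phi (2 * pi) = phi 0 by rewrite opprD addrACA subrr addr0.
  have := g2E (2 * pi); rewrite per2 g2E => -[/addrI e1 /addrI e2].
  have rE : rho (2 * pi) = rho 0.
    apply: (@pexpIrn _ 2) => //; rewrite ?nnegrE ?ltW //.
    transitivity ((rho 0 * cos (theta 0)) ^+ 2 + (rho 0 * sin (theta 0)) ^+ 2);
      last by rewrite !exprMn -mulrDr cos2Dsin2 mulr1.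
    by rewrite e1 e2 !exprMn -mulrDr cos2Dsin2 mulr1.
  have r0 : rho 0 != 0 by rewrite gt_eqF.
  move: e1 e2; rewrite rE => /(mulfI r0) e1 /(mulfI r0) e2.
  by rewrite /phi /a /b /v per1 e1 e2.
Qed.

Lemma circle_periodic z (e : R) : circle z e (2 * pi) = circle z e 0.
Proof. by rewrite /circle mulr_natl cos2pi sin2pi cos0 sin0. Qed.

Lemma continuous_circle z (e : R) : continuous (circle z e).
Proof.
move=> t.
apply: (@for_pair _ _ _ (fun t => z.1 + e * cos t) (fun t => z.2 + e * sin t));
  apply: cvgD; try exact: cvg_cst; apply: cvgM; try exact: cvg_cst.
- exact: continuous_cos.
- exact: continuous_sin.
Qed.

Lemma compact_circle z (e : R) : 0 < e ->
  compact [set w | (w.1 - z.1) ^+ 2 + (w.2 - z.2) ^+ 2 = e ^+ 2].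
Proof.
move=> e0; set C := mkset _.
have CE : C `<=` `[z.1 - e, z.1 + e] `*` `[z.2 - e, z.2 + e].
  move=> [x y]; rewrite /C/= => xy; split=> /=; rewrite in_itv/= -ler_distl;
    rewrite -[leRHS](ger0_norm (ltW e0)) -sqrtr_sqr -[leRHS]sqrtr_sqr;
    apply: ler_wsqrtr; rewrite -xy.
  - by rewrite lerDl sqr_ge0.
  - by rewrite lerDr sqr_ge0.
apply: subclosed_compact CE; last first.
  by apply: compact_setX; exact: segment_compact.
apply: (@preimage_closed _ _ (fun w : plane => (w.1 - z.1) ^+ 2 + (w.2 - z.2) ^+ 2)
  [set e ^+ 2]).
  move=> w _; apply: cvgD; rewrite !expr2; apply: cvgM; apply: cvgB;
   (exact: cvg_cst || exact: cvg_fst || exact: cvg_snd).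
exact: closed_eq.
Qed.

Lemma dot_self_gt0 (v : plane) : v != 0 -> 0 < dot v v.
Proof.
case: v => x y; rewrite /dot/= -!expr2 xpair_eqE negb_and => /orP[x0|y0].
- by rewrite ltr_pwDl ?sqr_ge0 // exprn_even_gt0.
- by rewrite ltr_pwDr ?sqr_ge0 // exprn_even_gt0.
Qed.

Lemma dotC (v w : plane) : dot v w = dot w v.
Proof. by rewrite /dot mulrC [_.2 * _]mulrC. Qed.

(** By injectivity [F t w - F t z] does not vanish for [w] on the circle; by compactness it makes an
    acute angle with its value at every nearby time, for all [w] at once. Hence the winding number
    is locally constant in time. *)
Lemma isotopy_orientation (F : R -> plane -> plane) (t0 t1 : R) :
  continuous (fun tz : R * plane => F tz.1 tz.2) ->
  (forall t, injective (F t)) ->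
  orientation_preserving (F t0) -> orientation_preserving (F t1).
Proof.
move=> cF injF o0 z e e0.
pose D t w := F t w - F t z.
pose C := [set w : plane | (w.1 - z.1) ^+ 2 + (w.2 - z.2) ^+ 2 = e ^+ 2].
have circC s : C (circle z e s).
  rewrite /C/circle/= !(addrC _ (e * _)) !addrK !exprMn -mulrDr cos2Dsin2.
  by rewrite mulr1.
have cFt t : continuous (F t).
  move=> w; apply: (for_comp2 (k := fun tz : R * plane => F tz.1 tz.2)) (cF (t, w)).
    exact: cvg_cst.
  exact: cvg_id.
pose P t := winding_number (F t \o circle z e) (F t z) 1.
apply: (@locally_constant_interval _ setT P is_intervalT _ t0 t1) => //; last exact: o0.
move=> t _.
have cD : continuous (fun tw : R * plane => D tw.1 tw.2).
  move=> tw; apply: cvgB; first exact: cF.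
  apply: (for_comp2 (k := fun tz : R * plane => F tz.1 tz.2)) (cF (tw.1, z)).
    exact: cvg_fst.
  exact: cvg_cst.
have := @compact_circle z e e0; rewrite -/C => /compact_near_coveringP.
move=> /(_ R (nbhs t) (fun t' w => 0 < dot (D t' w) (D t w)) _) nC.
have /nC : forall w, C w ->
    \forall w' \near w & t' \near t, 0 < dot (D t' w') (D t w').
  move=> w Cw.
  have Dw0 : 0 < dot (D t w) (D t w).
    apply: dot_self_gt0; rewrite /D subr_eq0; apply: contraTneq e0 => /injF wz.
    move: Cw; rewrite /C/= wz !subrr expr0n/= addr0 => /esym/eqP.
    by rewrite expf_eq0/= => /eqP ->; rewrite ltxx.
  have cdot : {for (w, t), continuous (fun q : plane * R => dot (D q.2 q.1) (D t q.1))}.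
    have c1 : {for (w, t), continuous (fun q : plane * R => D q.2 q.1)}.
      apply: (for_comp2 (k := fun tz : R * plane => D tz.1 tz.2)) (cD (t, w)).
        exact: cvg_snd.
      exact: cvg_fst.
    have c2 : {for (w, t), continuous (fun q : plane * R => D t q.1)}.
      apply: (for_comp2 (k := fun tz : R * plane => D tz.1 tz.2)) (cD (t, w)).
        exact: cvg_cst.
      exact: cvg_fst.
    apply: cvgD; apply: cvgM;
      [exact: for_fst c1|exact: for_fst c2|exact: for_snd c1|exact: for_snd c2].
  exact: (cdot _ (lt_nbhsr Dw0)).
apply: filterS => t' CP _; rewrite /P.
have per s : (F s \o circle z e) (2 * pi) = (F s \o circle z e) 0.
  by rewrite /= circle_periodic.
have cFc s : continuous (F s \o circle z e).
  by move=> x; apply: continuous_comp; [exact: continuous_circle|exact: cFt].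
have CP' s := CP _ (circC s).
split; apply: winding_number_acute => // s.
by rewrite dotC; exact: CP'.
Qed.

End Winding.

(** * Coordinates along leaves near a vertical leaf *)

Section LeafCoordinate.
Context {R : realType}.
Implicit Types (r s : R -> R) (a b c e m x y v : R).

Definition lin r s x y : R := r x + s x * y.

Definition leaf r s c x : R := (c - r x) / s x.

Lemma lin_leaf r s c x : s x != 0 -> lin r s x (leaf r s c x) = c.
Proof. by move=> sx; rewrite /lin /leaf mulrC divfK // addrC subrK. Qed.

Lemma leaf_lin r s x y : s x != 0 -> leaf r s (lin r s x y) x = y.
Proof. by move=> sx; rewrite /lin /leaf addrC addKr mulrC mulKf. Qed.

Lemma continuous_lin r s : continuous r -> continuous s ->
  continuous (fun z : R * R => lin r s z.1 z.2).
Proof.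
move=> cr cs z; apply: cvgD.
  by apply: (@continuous_comp _ _ _ fst r); [exact: cvg_fst|exact: cr].
apply: cvgM; last exact: cvg_snd.
by apply: (@continuous_comp _ _ _ fst s); [exact: cvg_fst|exact: cs].
Qed.

Lemma continuous_leaf r s x c : continuous r -> continuous s -> s x != 0 ->
  {for (x, c), continuous (fun z : R * R => leaf r s z.2 z.1)}.
Proof.
move=> cr cs sx; apply: cvgM.
  apply: cvgB; first exact: cvg_snd.
  by apply: (@continuous_comp _ _ _ fst r); [exact: cvg_fst|exact: cr].
apply: cvgV => //.
by apply: (@continuous_comp _ _ _ fst s); [exact: cvg_fst|exact: cs].
Qed.

Lemma atan_lt_ex v : - (pi / 2) < v -> exists y, atan y < v.
Proof.
move=> v0; have p0 : 0 < pi / 2 :> R by rewrite divr_gt0 // pi_gt0.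
(* The midpoint of [- (pi / 2)] and [Num.min v 0]; the truncation at 0 keeps it in the interval
   where [tan] inverts [atan]. *)
pose w := (Num.min v 0 - pi / 2) / 2.
have mv : Num.min v 0 <= v by rewrite ge_min lexx.
have m0 : Num.min v 0 <= 0 by rewrite ge_min lexx orbT.
have mp : - (pi / 2) < Num.min v 0 by rewrite lt_min v0 oppr_lt0.
exists (tan w); rewrite tanK; first by rewrite /w; lra.
by rewrite in_itv /= /w; apply/andP; split; lra.
Qed.

Lemma atan_gt_ex v : v < pi / 2 -> exists y, v < atan y.
Proof.
rewrite -ltrN2 => /atan_lt_ex[y yv]; exists (- y).
by rewrite atanN ltrNr.
Qed.

(** The end of a leaf at a bounding vertical leaf over [b] depends on the position of its level
    relative to [r b]; only leaves with equal positions are matched. *)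
Definition same_side r s c c' := forall b, s b = 0 ->
  (r b < c) = (r b < c') /\ (c < r b) = (c' < r b).

Definition left_dom s m : set R :=
  [set x | x <= m /\ forall t, x <= t <= m -> s t != 0].

(* A coordinate along the leaves of the part [left_dom s m] of a strip, which
   extends to the vertical leaf bounding it (if any). *)
Definition left_coord r s m (k : R -> R -> R) : Prop :=
  [/\ forall x c, left_dom s m x ->
        {for (x, c), continuous (fun w : R * R => k (Num.min w.1 m) w.2)},
      forall x x' c, left_dom s m x -> left_dom s m x' -> x < x' ->
        k x c < k x' c,
      forall c, k m c = 1,
      forall c c' x, same_side r s c c' -> left_dom s m x ->
        exists2 x', left_dom s m x' & k x' c' <= k x c
    & forall b y e, 0 < e -> b < m -> ~ left_dom s m b ->
        exists2 d : R, 0 < d & forall x x' y' c',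
          left_dom s m x -> left_dom s m x' ->
          same_side r s (lin r s x y') c' ->
          `|x - b| < d -> `|y' - y| < d -> `|c' - r b| < d ->
          k x' c' = k x (lin r s x y') ->
          `|x' - b| < e /\ `|leaf r s c' x' - y| < e].

Lemma left_dom_opp s m : left_dom (fun x => - s x) m = left_dom s m.
Proof.
by apply/seteqP; split=> x [xm sx]; split=> // t /sx; rewrite oppr_eq0.
Qed.

(** The reflection [y -> - y] changes the sign of [s]. Combined with a sign change of [p], as in
    [left_coord_oppr], it reduces every half strip to the case [s > 0] with levels increasing across
    the vertical leaf. *)
Lemma left_coord_opps r s m k :
  left_coord r (fun x => - s x) m k -> left_coord r s m k.
Proof.
rewrite /left_coord left_dom_opp => -[k1 k2 k3 k4 k5]; split=> //.
  move=> c c' x cc' Dx; apply: k4 => // b sb; apply: cc'.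
  by apply/eqP; rewrite -oppr_eq0 sb.
move=> b y e e0 bm Db; have [d d0 dP] := k5 b (- y) e e0 bm Db.
exists d => // x x' y' c' Dx Dx' cc' xb yy cb kk.
have E : lin r (fun x => - s x) x (- y') = lin r s x y'.
  by rewrite /lin mulrNN.
have [|||||] := dP x x' (- y') c' Dx Dx'; rewrite ?E //.
- by move=> t st; apply: cc'; apply/eqP; rewrite -oppr_eq0 st.
- by rewrite -opprD normrN.
by rewrite /leaf invrN mulrN -opprD normrN.
Qed.

Lemma left_coord_oppr r s m k : left_coord (fun x => - r x) s m k ->
  left_coord r s m (fun x c => k x (- c)).
Proof.
move=> [k1 k2 k3 k4 k5]; split=> //.
- move=> x c Dx.
  apply: (@continuous_comp _ _ _ (fun w : R * R => (w.1, - w.2))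
            (fun w : R * R => k (Num.min w.1 m) w.2)); last exact: k1.
  by apply: for_pair; [exact: cvg_fst|apply: cvgN; exact: cvg_snd].
- by move=> x x' c Dx Dx'; exact: k2.
- move=> c c' x cc' Dx; apply: k4 => // b sb.
  by have [h1 h2] := cc' b sb; rewrite !ltrN2 h1 h2.
move=> b y e e0 bm Db; have [d d0 dP] := k5 b (- y) e e0 bm Db.
exists d => // x x' y' c' Dx Dx' cc' xb yy cb kk.
have E : lin (fun x => - r x) s x (- y') = - lin r s x y'.
  by rewrite /lin mulrN opprD.
have [|||||] := dP x x' (- y') (- c') Dx Dx'; rewrite ?E //.
- by move=> t st; have [h1 h2] := cc' t st; rewrite !ltrN2 h1 h2.
- by rewrite -opprD normrN.
- by rewrite opprK addrC distrC.
move=> xb' ly; split=> //; move: ly.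
rewrite /leaf opprK (_ : - c' + r x' = - (c' - r x')) ?mulNr; last ring.
by rewrite -opprD normrN.
Qed.

(** * The normalized half strip: positive [s], levels increasing across the bounding vertical
    leaf *)

Section LeftCoordinate.
Variables (r s : R -> R) (a m : R).
Hypotheses (cr : continuous r) (cs : continuous s) (am : a < m)
  (sa : s a = 0) (s_gt0 : forall x, a < x <= m -> 0 < s x)
  (lin_incr : forall y, exists2 d : R, 0 < d &
     forall x x', a <= x -> x < x' -> x' < a + d -> lin r s x y < lin r s x' y).

Let u c x := leaf r s c x.

Let leafE x c y : a < x <= m -> (y < u c x) = (lin r s x y < c).
Proof.
move=> /s_gt0 sx; rewrite /u /leaf ltr_pdivlMr // /lin mulrC.
by rewrite ltrBrDl.
Qed.

Let leafE' x c y : a < x <= m -> (u c x < y) = (c < lin r s x y).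
Proof.
move=> /s_gt0 sx; rewrite /u /leaf ltr_pdivrMr // /lin mulrC.
by rewrite ltrBlDl.
Qed.

Let lina y : lin r s a y = r a. Proof. by rewrite /lin sa mul0r addr0. Qed.

Let S x c := [set atan (u c x') | x' in [set x' | a < x' <= x]].
Let A x c := inf (S x c).

Let lbS x c : lbound (S x c) (- (pi / 2)).
Proof. by move=> _ [t _ <-]; apply/ltW/atan_gtNpi2. Qed.

Let S0 x c : a < x -> S x c !=set0.
Proof. by move=> ax; exists (atan (u c x)), x => //=; rewrite ax lexx. Qed.

Let A_ge x c : a < x -> - (pi / 2) <= A x c.
Proof. by move=> ax; apply: lb_le_inf; [exact: S0|exact: lbS]. Qed.

Let A_le x c x' : a < x' <= x -> A x c <= atan (u c x').
Proof.
by move=> ax; apply: ge_inf; [exists (- (pi / 2)); exact: lbS|exists x'].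
Qed.

Let A_lt x c v : a < x -> A x c < v ->
  exists2 x', a < x' <= x & atan (u c x') < v.
Proof.
by move=> ax /inf_lt -/(_ (S0 c ax)) [_ [x' x'P <-]] lv; exists x'.
Qed.

Let le_A x c v : a < x -> (forall x', a < x' <= x -> v <= atan (u c x')) ->
  v <= A x c.
Proof.
move=> ax vP; apply: lb_le_inf; first exact: S0.
by move=> _ [t tP <-]; exact: vP.
Qed.

Let A_decr x x' c : a < x -> x <= x' -> A x' c <= A x c.
Proof.
move=> ax xx'; apply: le_A => // t /andP[at_ tx]; apply: A_le.
by rewrite at_ (le_trans tx).
Qed.

(** Such a leaf falls to minus infinity at [a]: at every height [y], points just to the right of [a]
    have level above [r a], so the leaf passes below them. *)
Let A_low x c : c <= r a -> a < x <= m -> A x c = - (pi / 2).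
Proof.
move=> ca /andP[ax xm]; apply/eqP; rewrite eq_le A_ge // andbT leNgt.
apply/negP => /atan_lt_ex [y yA]; have [d d0 dP] := lin_incr y.
pose t := Num.min x (a + d / 2).
have tx : t <= x by rewrite ge_min lexx.
have td : t < a + d.
  by rewrite (@le_lt_trans _ _ (a + d / 2)) ?ge_min ?lexx ?orbT //; lra.
have at_ : a < t by rewrite lt_min ax; lra.
have : atan (u c t) < atan y.
  apply: lt_atan; rewrite leafE' ?at_ ?(le_trans tx) //.
  by rewrite (le_lt_trans ca) // -(lina y); apply: dP.
by move=> /lt_trans /(_ yA); rewrite ltNge A_le // at_.
Qed.

(** Leaves of level above [r a] rise to infinity at [a], uniformly for levels at least [c], because
    the level at height [y] tends to [r a]. *)
Let A_high c y : r a < c -> exists2 d : R, 0 < d &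
  forall x, a < x < a + d -> x <= m -> forall c', c <= c' -> atan y <= A x c'.
Proof.
move=> ac.
have clin : {for a, continuous (fun x => lin r s x y)}.
  by apply: cvgD; [exact: cr|apply: cvgM; [exact: cs|exact: cvg_cst]].
have : lin r s a y < c by rewrite lina.
move=> /lt_nbhsl /clin /near_realP[d d0 dP]; exists d => // x /andP[ax xd] xm c' cc'.
apply: le_A => // t /andP[at_ tx]; apply/ltW/lt_atan.
rewrite leafE ?at_ ?(le_trans tx) // (lt_le_trans _ cc') //; apply: dP.
by rewrite gtr0_norm; lra.
Qed.

(** The reason why the infimum measures height near the vertical leaf: at height [y] levels increase
    with the abscissa, so a leaf that is above [y] at [x] was above [y] all the way from [a]. *)
Let A_edge y : exists2 d : R, 0 < d & forall x, a < x < a + d -> x <= m ->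
  forall y', y < y' -> r a < lin r s x y' /\ atan y <= A x (lin r s x y').
Proof.
have [d d0 dP] := lin_incr y; exists d => // x /andP[ax xd] xm y' yy'.
have ll : lin r s x y < lin r s x y'.
  by rewrite /lin ltrD2l ltr_pM2l // s_gt0 // ax.
split; first by rewrite -(lina y) (lt_trans _ ll) // dP.
apply: le_A => // t /andP[at_ tx]; apply/le_atan/ltW.
rewrite leafE ?at_ ?(le_trans tx) // (le_lt_trans _ ll) //.
move: tx; rewrite le_eqVlt => /predU1P[->//|tx].
by apply/ltW/dP => //; exact: ltW.
Qed.

Let continuous_atan_leaf x c : a < x <= m ->
  {for (x, c), continuous (fun z : R * R => atan (u z.2 z.1))}.
Proof.
move=> axm; apply: (@continuous_comp _ _ _ (fun z : R * R => u z.2 z.1) atan).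
  by apply: continuous_leaf => //; rewrite gt_eqF // s_gt0.
exact: continuous_atan.
Qed.

Let A_usc x c e : a < x <= m -> 0 < e -> exists2 d : R, 0 < d &
  forall x1 c1, `|x1 - x| < d -> `|c1 - c| < d -> A x1 c1 < A x c + e.
Proof.
move=> /andP[ax xm] e0.
have [//||t /andP[at_ tx] tA] := @A_lt x c (A x c + e); first by rewrite ltrDl.
have atm : a < t <= m by rewrite at_ (le_trans tx).
have := @continuous_atan_leaf t c atm _ (lt_nbhsl tA).
move=> /near_planeP[d d0 dP].
(* The nearly minimizing abscissa [t] is moved slightly to the left, so that it still lies below
   [x1] when [x1 < x]. *)
pose t' := Num.max ((a + t) / 2) (t - d / 2).
have at' : a < t' by rewrite lt_max; apply/orP; left; lra.
have t't : t' < t by rewrite gt_max; apply/andP; split; lra.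
have tt' : t - d / 2 <= t' by rewrite le_max lexx orbT.
exists (Num.min d (t - t')); first by rewrite lt_min d0 subr_gt0.
move=> x1 c1; rewrite !lt_min => /andP[_ x1x] /andP[c1c _].
apply: le_lt_trans (dP t' c1 _ _) => //=; last by rewrite ltr_norml; lra.
apply: A_le; rewrite at' /=; move: x1x; rewrite ltr_norml; lra.
Qed.

(** For [c <= r a] the infimum already has its least possible value. Otherwise [(a, x1]] is cut into
    three parts: near [a] the leaves of level at least [(c + r a) / 2] are uniformly high, on a
    compact interval up to [x] the heights vary uniformly with the level, and past [x] continuity at
    [x] suffices. *)
Let A_lsc x c e : a < x <= m -> 0 < e -> exists2 d : R, 0 < d &
  forall x1 c1, a < x1 <= m -> `|x1 - x| < d -> `|c1 - c| < d ->
    A x c - e < A x1 c1.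
Proof.
move=> axm e0; have /andP[ax xm] := axm.
have [ca|ac] := leP c (r a).
  exists 1 => // x1 c1 /andP[ax1 _] _ _; rewrite A_low //.
  by have := A_ge c1 ax1; lra.
have ac0 : r a < (c + r a) / 2 by lra.
have [d1 d1_gt0 d1P] := A_high (u c x) ac0.
have Au : A x c <= atan (u c x) by apply: A_le; rewrite ax lexx.
pose v := A x c - e / 2.
have cv t : a < t <= x -> \forall z \near (t, c), v < atan (u z.2 z.1).
  move=> /andP[at_ tx].
  have tm : a < t <= m by rewrite at_ (le_trans tx).
  suff vt : v < atan (u c t) by exact: (continuous_atan_leaf tm (lt_nbhsr vt)).
  apply: (@lt_le_trans _ _ (A x c)); first by rewrite /v; lra.
  by apply: A_le; rewrite at_.
have [|d2 d2_gt0 d2P] := (near_planeP _ _).1 (cv x _); first by rewrite ax lexx.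
have /compact_near_coveringP := @segment_compact _ (a + d1 / 2) x.
move=> /(_ R (nbhs c) (fun c1 t => v < atan (u c1 t)) _).
have H : forall t, `[a + d1 / 2, x]%classic t ->
    \forall t' \near t & c1 \near c, v < atan (u c1 t').
  by move=> t /=; rewrite in_itv/= => /andP[h1 h2]; apply: cv; rewrite h2; lra.
move=> /(_ H) /near_realP[d3 d3_gt0 d3P].
pose d4 := (c - r a) / 2.
exists (Num.min (Num.min d2 d3) d4); first by rewrite !lt_min d2_gt0 d3_gt0 /d4; lra.
move=> x1 c1 /andP[ax1 x1m]; rewrite !lt_min => /andP[/andP[x12 _] _].
move=> /andP[/andP[c12 c13]]; rewrite /d4 ltr_norml => c14.
apply: (@lt_le_trans _ _ v); first by rewrite /v; lra.
apply: le_A => // t /andP[at_ tx1].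
have [td|dt] := ltP t (a + d1).
  apply: (@le_trans _ _ (A t c1)); last by apply: A_le; rewrite at_ lexx.
  apply: le_trans (d1P t _ _ c1 _); rewrite ?at_ ?(le_trans tx1) //; last by lra.
  by rewrite /v; lra.
have [tx|xt] := leP t x.
  by apply/ltW/d3P => //=; rewrite in_itv/= tx andbT; lra.
apply/ltW; apply: d2P => //=; move: x12; rewrite !ltr_norml; lra.
Qed.

Let continuous_A x c : a < x <= m ->
  {for (x, c), continuous (fun z : R * R => A (Num.min z.1 m) z.2)}.
Proof.
move=> axm; have /andP[ax xm] := axm.
apply/cvgrPdist_lt => e e0.
have [d1 d1_gt0 d1P] := A_usc c axm e0.
have [d2 d2_gt0 d2P] := A_lsc c axm e0.
apply/near_planeP; exists (Num.min (Num.min d1 d2) (x - a)).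
  by rewrite !lt_min d1_gt0 d2_gt0 subr_gt0.
move=> x1 c1 /=; rewrite !lt_min => /andP[/andP[x11 x12] x1a] /andP[/andP[c11 c12] _].
have mx : Num.min x m = x by apply/min_idPl.
have ax1 : a < x1 by move: x1a; rewrite ltr_norml; lra.
have am1 : a < Num.min x1 m <= m by rewrite lt_min ax1 am ge_min lexx orbT.
have near1 : `|Num.min x1 m - x| <= `|x1 - x|.
  by case: (leP x1 m) => // mx1; rewrite !ger0_norm; lra.
rewrite mx ltr_norml; apply/andP; split.
  have := d1P (Num.min x1 m) c1 (le_lt_trans near1 x11) c11; lra.
have := d2P (Num.min x1 m) c1 am1 (le_lt_trans near1 x12) c12; lra.
Qed.

(** [A] is only weakly decreasing in [x]; the summand [x - a] makes [N] strictly increasing, and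
    [pi / 2] makes it positive. *)
Let N x c := pi / 2 + (x - a) - A x c.

Let A_lt_pi2 x c : a < x <= m -> A x c < pi / 2.
Proof.
move=> /andP[ax _]; apply: (@le_lt_trans _ _ (atan (u c x))).
  by apply: A_le; rewrite ax lexx.
exact: atan_ltpi2.
Qed.

Let N_gt0 x c : a < x <= m -> 0 < N x c.
Proof. by move=> axm; have := A_lt_pi2 c axm; rewrite /N; case/andP: axm; lra. Qed.

Let amm : a < m <= m. Proof. by rewrite am lexx. Qed.

(** The quotient is 1 at [m] for every level, as gluing with the other half strip demands. As [c]
    tends to [r a] the denominator tends to [pi + (m - a)], so it does not disturb the behaviour at
    the vertical leaf. *)
Let k x c := N x c / N m c.

Let domE x : left_dom s m x <-> a < x <= m.
Proof.
split=> [[xm xs]|/andP[ax xm]].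
  rewrite xm andbT ltNge; apply/negP => xa.
  by have := xs a; rewrite xa (ltW am) sa eqxx => /(_ isT).
by split=> // t /andP[xt tm]; rewrite gt_eqF // s_gt0 // (lt_le_trans ax).
Qed.

Let continuous_k x c : a < x <= m ->
  {for (x, c), continuous (fun w : R * R => k (Num.min w.1 m) w.2)}.
Proof.
move=> axm; have /andP[ax xm] := axm.
have mx : Num.min x m = x by apply/min_idPl.
have cN t d : a < t <= m ->
    {for (t, d), continuous (fun w : R * R => N (Num.min w.1 m) w.2)}.
  move=> atm; apply: cvgB; last exact: continuous_A.
  apply: cvgD; first exact: cvg_cst.
  apply: cvgB; last exact: cvg_cst.
  by apply: continuous_min; [exact: cvg_fst|exact: cvg_cst].
apply: cvgM; first exact: cN.
apply: cvgV; first by rewrite gt_eqF // N_gt0.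
have : {for (x, c), continuous (fun w : R * R => N (Num.min m m) w.2)}.
  apply: (@for_comp2 _ _ _ _ (fun=> m) snd
    (fun w : R * R => N (Num.min w.1 m) w.2)); last exact: cN.
    exact: cvg_cst.
  exact: cvg_snd.
by rewrite minxx.
Qed.

(** For levels near [r a] the denominators are nearly equal, so equal coordinates give nearly equal
    [N]. First the summand [x - a] forces [x'] to be near [a]; then the infima are nearly equal and,
    near the vertical leaf, they control the heights. *)
Let k_cvg_vertical y e : 0 < e ->
  exists2 d : R, 0 < d & forall x x' y' c', a < x <= m -> a < x' <= m ->
    `|x - a| < d -> `|y' - y| < d -> `|c' - r a| < d ->
    k x' c' = k x (lin r s x y') ->
    `|x' - a| < e /\ `|leaf r s c' x' - y| < e.
Proof.
move=> e0.
pose y1 := y - e / 2; pose y2 := y + e / 2; pose y3 := y + 3 * e / 4.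
pose gap1 := atan y1 - atan (y - e); pose gap2 := atan y3 - atan y2.
have gap1_gt0 : 0 < gap1 by rewrite subr_gt0; apply: lt_atan; rewrite /y1; lra.
have gap2_gt0 : 0 < gap2.
  by rewrite subr_gt0; apply: lt_atan; rewrite /y2 /y3; lra.
have [d1 d1_gt0 d1P] := A_edge y1.
have [d3 d3_gt0 d3P] := A_edge y3.
(* [x'] will be trapped within [dl] of [a]; [eta] below bounds the distance of the infima at [m] and
   at [a + dl] from [- (pi / 2)]. Both are small compared with the gaps that separate the target
   heights after [atan]. *)
pose dl := Num.min (Num.min e d3) (Num.min (gap2 / 4) ((m - a) / 2)).
have dl_gt0 : 0 < dl by rewrite !lt_min e0 d3_gt0 !divr_gt0 // subr_gt0.
have [dle dld3 dlg dlm] : [/\ dl <= e, dl <= d3, dl <= gap2 / 4 & dl <= (m - a) / 2].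
  by split; rewrite /dl !ge_min lexx ?orbT.
pose eta := Num.min (Num.min (dl / 8) (gap1 / 4)) ((m - a) / 2).
have eta_gt0 : 0 < eta by rewrite !lt_min !divr_gt0 // subr_gt0.
have [etad etag etam] : [/\ eta <= dl / 8, eta <= gap1 / 4 & eta <= (m - a) / 2].
  by split; rewrite /eta !ge_min lexx ?orbT.
have adm : a < a + dl <= m by apply/andP; split; lra.
have [d4 d4_gt0 d4P] := A_usc (r a) amm eta_gt0.
have [d5 d5_gt0 d5P] := A_usc (r a) adm eta_gt0.
have := @continuous_lin r s cr cs (a, y).
move=> /cvgrPdist_lt /(_ d4 d4_gt0) /near_planeP[d6 d6_gt0 d6P] /=.
pose d := Num.min (Num.min (Num.min d1 (dl / 8)) (Num.min (gap1 / 4) (e / 2)))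
   (Num.min (Num.min d4 d5) d6).
exists d; first by rewrite /d !lt_min d1_gt0 d4_gt0 d5_gt0 d6_gt0 !divr_gt0.
move=> x x' y' c' axm ax'm; rewrite !lt_min.
move=> /andP[/andP[/andP[xd1 xdl] /andP[xg1 _]] /andP[_ xd6]].
move=> /andP[/andP[_ /andP[_ y'e]] /andP[_ y'd6]].
move=> /andP[_ /andP[/andP[c'd4 c'd5] _]].
set c := lin r s x y'; set y'' := leaf r s c' x' => kk.
have cd4 : `|c - r a| < d4 by rewrite distrC -(lina y); exact: d6P.
have [ax xm] := andP axm; have [ax' x'm] := andP ax'm.
have Tlo : atan y1 <= A x c.
  apply: (d1P x _ xm y' _).2.
    by move: xd1; rewrite ltr_norml; lra.
  by move: y'e; rewrite ltr_norml /y1; lra.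
have Thi : A x c < atan y2.
  apply: (@le_lt_trans _ _ (atan (u c x))); first by apply: A_le; rewrite ax lexx.
  apply: lt_atan; rewrite /u /c leaf_lin; last by rewrite gt_eqF // s_gt0.
  by move: y'e; rewrite ltr_norml /y2; lra.
have Am0 : A m (r a) = - (pi / 2) by rewrite A_low.
have Ad0 : A (a + dl) (r a) = - (pi / 2) by rewrite A_low.
have Nmc : A m c < - (pi / 2) + eta by rewrite -Am0; apply: d4P; rewrite ?subrr ?normr0.
have Nmc' : A m c' < - (pi / 2) + eta by rewrite -Am0; apply: d4P; rewrite ?subrr ?normr0.
have Ndc' : A (a + dl) c' < - (pi / 2) + eta.
  by rewrite -Ad0; apply: d5P; rewrite ?subrr ?normr0.
have Nlo t w : a < t -> - (pi / 2) <= A t w := @A_ge t w.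
have pi0 : 0 < pi :> R := pi_gt0 R.
(* Both denominators are within [eta] of [pi + (m - a)], and [N x c] is at most this number, hence
   at most twice [N m c]. *)
have NN : `|N x' c' - N x c| <= 2 * eta.
  have Nmc0 : 0 < N m c by exact: N_gt0.
  have Nmc'0 : 0 < N m c' by exact: N_gt0.
  have kN : N x' c' * N m c = N x c * N m c'.
    have : N x' c' / N m c' = N x c / N m c by [].
    by move=> /eqP; rewrite eqr_div ?lt0r_neq0 // => /eqP.
  have Nx0 : 0 < N x c by exact: N_gt0.
  have Nx1 : N x c <= pi + (m - a) by have := Nlo x c ax; rewrite /N; lra.
  have Nc1 : N m c <= pi + (m - a) by have := Nlo m c am; rewrite /N; lra.
  have Nc'1 : N m c' <= pi + (m - a) by have := Nlo m c' am; rewrite /N; lra.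
  have Nc2 : pi + (m - a) - eta <= N m c by rewrite /N; lra.
  have Nc'2 : pi + (m - a) - eta <= N m c' by rewrite /N; lra.
  have Nc3 : (pi + (m - a)) / 2 <= N m c by lra.
  have E : (N x' c' - N x c) * N m c = N x c * (N m c' - N m c).
    move: kN; move: (N x' c') (N x c) (N m c) (N m c') => n1 n2 n3 n4 h.
    by rewrite mulrBl h mulrBr.
  rewrite -(ler_pM2r Nmc0) -{1}(gtr0_norm Nmc0) -normrM E normrM (gtr0_norm Nx0).
  apply: (@le_trans _ _ (N x c * eta)).
    by rewrite ler_pM2l // ler_norml; apply/andP; split; lra.
  rewrite -mulrA (mulrC eta) mulrA ler_pM2r //; lra.
move: NN; rewrite /N ler_norml => NN.
(* Past [a + dl] the infimum is almost [- (pi / 2)] and the summand [x' - a] is at least [dl], so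
   [N x' c'] would exceed [N x c], which is at most [pi + (x - a)], by more than [2 * eta]. *)
have x'dl : x' < a + dl.
  rewrite ltNge; apply/negP => dlx'.
  have : A x' c' <= A (a + dl) c' by apply: A_decr => //; lra.
  move: xdl; rewrite ltr_norml.
  have := Nlo x c ax; lra.
split; first by rewrite ltr_norml; lra.
have A'le : A x' c' <= atan y'' by apply: A_le; rewrite ax' lexx.
(* Too low a point would pull the infimum down to its own height; too high a point would, by
   [A_edge], keep it above [atan y3]. Both contradict the closeness of the two infima. *)
rewrite ltr_norml; apply/andP; split; rewrite ltNge; apply/negP => yy.
  have : atan y'' <= atan (y - e) by apply: le_atan; lra.
  move: xg1; rewrite ltr_norml; rewrite /gap1 in etag *; lra.
have y''c' : lin r s x' y'' = c' by rewrite lin_leaf // gt_eqF // s_gt0.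
have [||_] := d3P x' _ x'm y''; rewrite ?y''c'.
- by apply/andP; split; lra.
- by rewrite /y3; lra.
rewrite /gap2 in dlg *; lra.
Qed.

Lemma left_coord_incr : left_coord r s m k.
Proof.
split.
- by move=> x c /domE; exact: continuous_k.
- move=> x x' c /domE axm /domE ax'm xx'; rewrite /k ltr_pM2r ?invr_gt0 ?N_gt0 //.
  have /andP[ax _] := axm.
  by have := A_decr c ax (ltW xx'); rewrite /N; lra.
- by move=> c; rewrite /k divff // gt_eqF // N_gt0.
- move=> c c' x cc' /domE axm; have /andP[ax xm] := axm.
  (* Up to [r a] the coordinate does not depend on the level, so the same abscissa serves. Above
     [r a], [N] tends to 0 at the vertical leaf: one half of [e] is left for [x' - a] and the other
     for [pi / 2 - A]. *)
  have [ca|ac] := leP c (r a).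
    have c'a : c' <= r a by rewrite leNgt -(cc' a sa).1 -leNgt.
    by exists x; [apply/domE|rewrite /k /N !A_low].
  have ac' : r a < c' by rewrite -(cc' a sa).1.
  pose e := k x c * N m c'.
  have e0 : 0 < e by rewrite /e /k mulr_gt0 ?divr_gt0 ?N_gt0.
  have [|y yP] := @atan_gt_ex (pi / 2 - e / 2); first by lra.
  have [d d0 dP] := A_high y ac'.
  pose x' := Num.min m (a + Num.min (d / 2) (e / 2)).
  have ax' : a < x' by rewrite lt_min am ltrDl lt_min !divr_gt0.
  have x'm : x' <= m by rewrite ge_min lexx.
  have x'd : x' <= a + d / 2.
    by rewrite ge_min lerD2l ge_min lexx orbT.
  have x'e : x' <= a + e / 2.
    by rewrite ge_min lerD2l ge_min lexx !orbT.
  exists x'; first by apply/domE; rewrite ax'.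
  rewrite {1}/k ler_pdivrMr ?N_gt0 // -/e /N.
  have := dP x' _ x'm c' (lexx _); rewrite ax' /= => /(_ _); lra.
- move=> b y e e0 bm Db.
  have [ab|ba|->] := ltgtP b a; last first.
  + have [d d0 dP] := k_cvg_vertical y e0; exists d => //.
    by move=> x x' y' c' /domE axm /domE ax'm _; exact: dP.
  + by case: Db; apply/domE; rewrite ba ltW.
  + exists (a - b) => [|x x' y' c' /domE /andP[ax _] _ _]; first by rewrite subr_gt0.
    by rewrite ltr_norml; lra.
Qed.

End LeftCoordinate.
End LeafCoordinate.

(** * Coordinates along the leaves of a strip *)

Section Strips.
Context {R : realType}.
Implicit Types (r s : R -> R) (a b c e m x y v : R).

(** This is all that is kept of the submersion condition. The direction of crossing is the same at
    all heights, whereas the width [d] depends on the height. *)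
Definition transverse r s := forall a, s a = 0 ->
  (forall y, exists2 d : R, 0 < d & forall x x', a - d < x -> x < x' ->
     x' < a + d -> lin r s x y < lin r s x' y) \/
  (forall y, exists2 d : R, 0 < d & forall x x', a - d < x -> x < x' ->
     x' < a + d -> lin r s x' y < lin r s x y).

Definition regular r s :=
  [/\ continuous r, continuous s, finite_set [set x | s x = 0]
    & transverse r s].

Lemma continuous_withinT (T : topologicalType) (f : R -> T) (A : set R) :
  continuous f -> {within A, continuous f}.
Proof. by move=> cf; apply: continuous_subspaceT. Qed.

Lemma sign_constant s x x' : continuous s -> x <= x' ->
  (forall t, x <= t <= x' -> s t != 0) -> 0 < s x' -> 0 < s x.
Proof.
move=> cs xx' sn0 sx'; rewrite ltNge; apply/negP => sx.
have [|t] := @IVT _ s x x' 0 xx' (continuous_withinT (A := _) cs).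
  by rewrite ge_min sx le_max (ltW sx') orbT.
by rewrite in_itv/= => /sn0 /eqP.
Qed.

Lemma last_zero s m : continuous s -> s m != 0 ->
  (forall x, x <= m -> s x != 0) \/
  exists a, [/\ a < m, s a = 0 & forall x, a < x <= m -> s x != 0].
Proof.
move=> cs sm; pose Z := [set x | x <= m /\ s x = 0].
have [Z0|/forallNP nZ] := pselect (Z !=set0); last first.
  by left=> x xm; apply/eqP => sx; apply: (nZ x).
right; have hZ : has_sup Z by split=> //; exists m => x [].
pose a := sup Z.
have am : a <= m by apply: ge_sup => // x [].
have sa : s a = 0.
  apply: contrapT => /eqP sa.
  have : \forall x \near a, s x != 0.
    have := cs a; move/cvgrPdist_lt => /(_ `|s a|); rewrite normr_gt0 => /(_ sa).
    apply: filterS => x; apply: contraTneq => ->.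
    by rewrite subr0 ltxx.
  move=> /near_realP[d d0 dP].
  have [x [xm sx] ax] := sup_adherent d0 hZ.
  have xa : x <= a by apply: ub_le_sup => //; exact: hZ.2.
  by move: sx; apply/eqP/dP; rewrite distrC ger0_norm ?subr_ge0 //; move: ax; rewrite -/a; lra.
exists a; split=> // [|x /andP[ax xm]].
  rewrite lt_neqAle am andbT; apply: contraNneq sm => <-; exact/eqP.
apply/eqP => sx; move: ax; rewrite ltNge => /negP; apply.
by apply: ub_le_sup => //; exact: hZ.2.
Qed.

Lemma left_coord_exists r s m : continuous r -> continuous s ->
  transverse r s -> s m != 0 -> exists k, left_coord r s m k.
Proof.
move=> cr cs tr sm.
have [nz|[a [am sa sn0]]] := last_zero cs sm.
  have domE x : left_dom s m x <-> x <= m.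
    by split=> [[]//|xm]; split=> // t /andP[_]; exact: nz.
  (* No vertical leaf bounds this half strip, so the abscissa is a coordinate, normalized to 1 at
     [m]. *)
  exists (fun x _ => 1 + x - m); split.
  - move=> x c _; apply: cvgB; last exact: cvg_cst.
    apply: cvgD; first exact: cvg_cst.
    by apply: continuous_min; [exact: cvg_fst|exact: cvg_cst].
  - by move=> x x' _ _ _; lra.
  - by move=> _; lra.
  - by move=> c c' x _ Dx; exists x.
  - by move=> b y e _ bm []; apply/domE/ltW.
have incr_case r1 s1 : continuous r1 -> continuous s1 -> s1 a = 0 ->
    (forall x, a < x <= m -> s1 x != 0) -> 0 < s1 m ->
    (forall y, exists2 d : R, 0 < d & forall x x', a - d < x -> x < x' ->
     x' < a + d -> lin r1 s1 x y < lin r1 s1 x' y) ->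
    exists k, left_coord r1 s1 m k.
  move=> cr1 cs1 s1a s1n0 s1m inc.
  have s1_gt0 x : a < x <= m -> 0 < s1 x.
    move=> /andP[ax xm]; apply: (sign_constant cs1 xm) => // t /andP[xt tm].
    by apply: s1n0; rewrite tm (lt_le_trans ax).
  have inc' y : exists2 d : R, 0 < d & forall x x', a <= x -> x < x' ->
     x' < a + d -> lin r1 s1 x y < lin r1 s1 x' y.
    have [d d0 dP] := inc y; exists d => // x x' ax xx' x'd.
    by apply: dP => //; lra.
  by have := left_coord_incr cr1 cs1 am s1a s1_gt0 inc'; eexists; eauto.
have cN (f : R -> R) : continuous f -> continuous (fun x => - f x).
  by move=> cf x; apply: cvgN; exact: cf.
have n0N : forall x, a < x <= m -> - s x != 0.
  by move=> x axm; rewrite oppr_eq0 sn0.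
have [sm0|sm0] : 0 < s m \/ 0 < - s m.
  by have [h|h|h] := ltgtP (s m) 0; [right; rewrite oppr_gt0|left|rewrite h eqxx in sm].
- have [inc|dec] := tr a sa; first exact: incr_case.
  have [|k kP] := incr_case (fun x => - r x) s (cN _ cr) cs sa sn0 sm0.
    move=> y; have [d d0 dP] := dec (- y); exists d => // x x' h1 h2 h3.
    have := dP x x' h1 h2 h3; rewrite /lin !mulrN.
    by rewrite -ltrN2 !opprB ![_ - _]addrC.
  by exists (fun x c => k x (- c)); exact: left_coord_oppr.
- have sa' : - s a = 0 by rewrite sa oppr0.
  have [inc|dec] := tr a sa.
    have [|k kP] := incr_case r (fun x => - s x) cr (cN _ cs) sa' n0N sm0.
      move=> y; have [d d0 dP] := inc (- y); exists d => // x x' h1 h2 h3.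
      by have := dP x x' h1 h2 h3; rewrite /lin !mulrN !mulNr.
    by exists k; exact: left_coord_opps.
  have [|k kP] := incr_case (fun x => - r x) (fun x => - s x) (cN _ cr) (cN _ cs)
     sa' n0N sm0.
    move=> y; have [d d0 dP] := dec y; exists d => // x x' h1 h2 h3.
    by have := dP x x' h1 h2 h3; rewrite /lin !mulNr -!opprD ltrN2.
  by exists (fun x c => k x (- c)); apply/left_coord_oppr/left_coord_opps.
Qed.

Definition strip s m : set R :=
  [set x | forall t, Num.min m x <= t <= Num.max m x -> s t != 0].

(** The third clause provides a partner of equal coordinate on a leaf of the same side; the second
    makes it unique. The last one is the estimate by which the matching extends by the identity to
    the vertical leaves bounding the strip. *)
Definition strip_coord r s m (K : R -> R -> R) : Prop :=
  [/\ forall x c, strip s m x ->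
        {for (x, c), continuous (fun w : R * R => K w.1 w.2)},
      forall x x' c, strip s m x -> strip s m x' -> x < x' -> K x c < K x' c,
      forall c c' x, same_side r s c c' -> strip s m x ->
        exists2 x', strip s m x' & K x' c' = K x c
    & forall b y e, 0 < e -> ~ strip s m b ->
        exists2 d : R, 0 < d & forall x x' y' c',
          strip s m x -> strip s m x' ->
          same_side r s (lin r s x y') c' ->
          `|x - b| < d -> `|y' - y| < d -> `|c' - r b| < d ->
          K x' c' = K x (lin r s x y') ->
          `|x' - b| < e /\ `|leaf r s c' x' - y| < e].

(** The right half strip is treated as a left one after [x -> - x]. The truncations turn the
    coordinate of the other half into the constant 1, so this is [kl - 1] left of [m] and [1 - kr]
    right of it, and it vanishes at [m]. *)
Definition gluing m (kl kr : R -> R -> R) x c : R :=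
  kl (Num.min x m) c - kr (Num.min (- x) (- m)) c.

Lemma strip_left s m x : x <= m -> strip s m x <-> left_dom s m x.
Proof.
move=> xm; rewrite /strip /left_dom /=; rewrite (min_idPr xm) (max_idPl xm).
by split=> [|[]].
Qed.

Lemma strip_opp s m x :
  strip (s \o -%R) (- m) (- x) <-> strip s m x.
Proof.
rewrite /strip /= -oppr_max -oppr_min; split=> h t tP.
  by rewrite -[t]opprK; apply: h; rewrite !lerN2 andbC.
by apply: h; rewrite lerNl lerNr andbC.
Qed.

Lemma left_dom_refl s m : s m != 0 -> left_dom s m m.
Proof. by move=> sm; split=> // t; rewrite -eq_le => /eqP <-. Qed.

Lemma same_side_opp r s c c' :
  same_side (r \o -%R) (s \o -%R) c c' <-> same_side r s c c'.
Proof.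
split=> h b sb; last exact: h.
by have := h (- b); rewrite /= opprK; exact.
Qed.

Lemma left_coord_continuous r s m k x c : s m != 0 -> left_coord r s m k ->
  left_dom s m x \/ m <= x ->
  {for (x, c), continuous (fun w : R * R => k (Num.min w.1 m) w.2)}.
Proof.
move=> sm [k1 _ _ _ _] [|mx]; first exact: k1.
have : {for (x, c), continuous
    (fun w : R * R => k (Num.min (Num.min w.1 m) m) w.2)}.
  apply: (@for_comp2 _ _ _ _ (fun w : R * R => Num.min w.1 m) snd
    (fun w : R * R => k (Num.min w.1 m) w.2)).
  - by apply: continuous_min; [exact: cvg_fst|exact: cvg_cst].
  - exact: cvg_snd.
  - by rewrite (min_idPr mx); apply: k1; exact: left_dom_refl.
rewrite (_ : (fun w => _) = (fun w : R * R => k (Num.min w.1 m) w.2)) //.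
by apply/funext => w; rewrite -minA minxx.
Qed.

(** * Gluing the coordinates of two half strips *)

Section Gluing.
Variables (r s : R -> R) (m : R) (kl kr : R -> R -> R).
Hypotheses (cr : continuous r) (cs : continuous s) (sm : s m != 0).
Hypothesis HL : left_coord r s m kl.
Hypothesis HR : left_coord (r \o -%R) (s \o -%R) (- m) kr.

Let K := gluing m kl kr.

Lemma gluing_opp x c : gluing (- m) kr kl (- x) c = - K x c.
Proof. by rewrite /K /gluing !opprK opprB. Qed.

Lemma gluing_left x c : x <= m -> K x c = kl x c - 1.
Proof.
move=> xm; rewrite /K /gluing (min_idPl xm) (min_idPr _) ?lerN2 //.
by have [_ _ -> _ _] := HR.
Qed.

Lemma gluing_le x x' c : left_dom s m x -> left_dom s m x' -> x <= x' ->
  kl x c <= kl x' c.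
Proof.
have [_ k2 _ _ _] := HL => Dx Dx'; rewrite le_eqVlt => /predU1P[->//|xx'].
exact/ltW/k2.
Qed.

(** The sign of the coordinate tells the side of the base point, so matched points lie in the same
    half strip. *)
Lemma gluing_neg x c : strip s m x -> (K x c < 0) = (x < m).
Proof.
move=> Sx; have [_ k2 k3 _ _] := HL; have [_ k2' k3' _ _] := HR.
have [xm|mx] := ltP x m.
  rewrite gluing_left ?ltW // subr_lt0 -(k3 c) k2 //.
    by apply/strip_left => //; exact: ltW.
  exact: left_dom_refl.
apply/negbTE; rewrite -leNgt /K /gluing (min_idPr mx) (min_idPl _) ?lerN2 // k3.
rewrite subr_ge0 -(k3' c); move: mx; rewrite le_eqVlt => /predU1P[->//|mx].
apply/ltW/k2'; rewrite ?ltrN2 //.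
  apply/strip_left; first by rewrite lerN2 ltW.
  exact/strip_opp.
by apply: left_dom_refl; rewrite /= opprK.
Qed.

(** On the leaf of level [c'] the coordinate is at most [kl x c] somewhere and 1 at [m]; the
    intermediate value theorem gives the partner. *)
Lemma gluing_match_left c c' x : same_side r s c c' -> strip s m x -> x <= m ->
  exists2 x', strip s m x' & K x' c' = K x c.
Proof.
move=> cc' Sx xm; have Dx : left_dom s m x by apply/strip_left.
have [k1 k2 k3 k4 _] := HL.
have [x0 Dx0 x0P] := k4 c c' x cc' Dx.
have x0m : x0 <= m by case: Dx0.
have ck : {within `[x0, m], continuous (fun t => kl (Num.min t m) c')}.
  apply: continuous_in_subspaceT => t; rewrite inE/= in_itv/= => /andP[x0t tm].
  apply: (@for_comp2 _ _ _ _ id (fun=> c') (fun w : R * R => kl (Num.min w.1 m) w.2)).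
  - exact: cvg_id.
  - exact: cvg_cst.
  - apply: k1; case: Dx0 => _ h; split=> // t' /andP[tt' t'm].
    by apply: h; rewrite t'm (le_trans x0t).
have := IVT (v := kl x c) x0m ck; rewrite minxx (min_idPl x0m).
have x1 : kl x c <= 1.
  by rewrite -(k3 c); apply: gluing_le => //; exact: left_dom_refl.
case=> [|x']; first by rewrite ge_min x0P le_max k3 x1 orbT.
rewrite in_itv/= => /andP[x0x' x'm]; rewrite (min_idPl x'm) => x'P.
exists x'; last by rewrite !gluing_left // x'P.
apply/strip_left => //; case: Dx0 => _ h; split=> // t' /andP[tt' t'm].
by apply: h; rewrite t'm (le_trans x0x').
Qed.

Lemma gluing_vertical_left b y e : 0 < e -> b < m -> ~ strip s m b ->
  exists2 d : R, 0 < d & forall x x' y' c',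
          strip s m x -> strip s m x' ->
          same_side r s (lin r s x y') c' ->
          `|x - b| < d -> `|y' - y| < d -> `|c' - r b| < d ->
          K x' c' = K x (lin r s x y') ->
          `|x' - b| < e /\ `|leaf r s c' x' - y| < e.
Proof.
move=> e0 bm Sb; have [_ _ _ _ k5] := HL.
have [|d d0 dP] := k5 b y e e0 bm; first by rewrite -strip_left // ltW.
(* The bound [m - b] keeps [x] left of [m]; by the sign of the coordinate [x'] is left of [m]
   too. *)
exists (Num.min d (m - b)); first by rewrite lt_min d0 subr_gt0.
move=> x x' y' c' Sx Sx' cc'; rewrite !lt_min.
move=> /andP[xd xm] /andP[yd _] /andP[cd _] kk.
have {}xm : x < m by move: xm; rewrite ltr_norml; lra.
have x'm : x' < m by rewrite -(gluing_neg c') // kk gluing_neg.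
apply: (dP x x' y' c') => //; try by apply/strip_left => //; exact: ltW.
by move: kk; rewrite !gluing_left ?ltW // => /addIr.
Qed.

End Gluing.

Lemma strip_coord_exists r s m : continuous r -> continuous s ->
  transverse r s -> s m != 0 -> exists K, strip_coord r s m K.
Proof.
move=> cr cs tr sm.
have cN (f : R -> R) : continuous f -> continuous (f \o -%R).
  by move=> cf x; apply: continuous_comp; [exact: opp_continuous|exact: cf].
have tr' : transverse (r \o -%R) (s \o -%R).
  move=> a sa; have [inc|dec] := tr (- a) sa; [right|left] => y.
    have [d d0 dP] := inc y; exists d => // x x' h1 h2 h3.
    by apply: dP; lra.
  have [d d0 dP] := dec y; exists d => // x x' h1 h2 h3.
  by apply: dP; lra.
have sm' : (s \o -%R) (- m) != 0 by rewrite /= opprK.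
have [kl HL] := left_coord_exists cr cs tr sm.
have [kr HR] := left_coord_exists (cN _ cr) (cN _ cs) tr' sm'.
have HL' : left_coord ((r \o -%R) \o -%R) ((s \o -%R) \o -%R) (- - m) kl.
  rewrite opprK (_ : _ \o _ = r); last by apply/funext => x /=; rewrite opprK.
  by rewrite (_ : _ \o _ = s) //; apply/funext => x /=; rewrite opprK.
have GE := gluing_opp m kl kr.
exists (gluing m kl kr); split.
- move=> x c Sx.
  have C1 : {for (x, c), continuous (fun w : R * R => kl (Num.min w.1 m) w.2)}.
    apply: (left_coord_continuous sm HL); have [xm|mx] := lerP x m.
      by left; apply/strip_left.
    by right; exact: ltW.
  have C2 : {for (x, c), continuous
      (fun w : R * R => kr (Num.min (- w.1) (- m)) w.2)}.
    apply: (@for_comp2 _ _ _ _ (fun w : R * R => - w.1) snd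
      (fun w : R * R => kr (Num.min w.1 (- m)) w.2)).
    + by apply: cvgN; exact: cvg_fst.
    + exact: cvg_snd.
    + apply: (left_coord_continuous sm' HR); have [xm|mx] := lerP x m.
        by right; rewrite lerN2.
      left; apply/strip_left; first by rewrite lerN2 ltW.
      exact/strip_opp.
  exact: (cvgB C1 C2).
- move=> x x' c Sx Sx' xx'.
  have [mx|xm] := leP m x.
    rewrite -ltrN2 -!GE.
    have Sx1 : strip (s \o -%R) (- m) (- x) by apply/strip_opp.
    have Sx1' : strip (s \o -%R) (- m) (- x') by apply/strip_opp.
    have xm1 : - x <= - m by rewrite lerN2.
    have xm1' : - x' <= - m by rewrite lerN2 (le_trans mx) ?ltW.
    rewrite (gluing_left _ HL' c xm1) (gluing_left _ HL' c xm1') ltrD2r.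
    have [_ k2 _ _ _] := HR; apply: k2; rewrite ?ltrN2 //.
      by apply/strip_left => //; rewrite lerN2 (le_trans mx) ?ltW.
    by apply/strip_left => //; rewrite lerN2.
  have [mx'|x'm] := leP m x'.
    have h := gluing_neg sm HL HR.
    by rewrite (@lt_le_trans _ _ 0) ?h // leNgt h // -leNgt.
  rewrite !(gluing_left _ HR) ?ltW // ltrD2r.
  by have [_ k2 _ _ _] := HL; apply: k2 => //; apply/strip_left => //; exact: ltW.
- move=> c c' x cc' Sx; have [xm|mx] := leP x m.
    exact: (gluing_match_left sm HL HR cc' Sx xm).
  have [| | |x' Sx' x'P] := gluing_match_left (c := c) (c' := c') (x := - x) sm' HR HL'.
  + exact/same_side_opp.
  + exact/strip_opp.
  + by rewrite lerN2 ltW.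
  exists (- x'); first by apply/strip_opp; rewrite opprK.
  by apply: oppr_inj; rewrite -!GE opprK.
- move=> b y e e0 Sb.
  have [bm|mb|bm] := ltgtP b m.
  + exact: (gluing_vertical_left sm HL HR y e0 bm Sb).
  + have [||d d0 dP] := gluing_vertical_left (b := - b) sm' HR HL' y e0.
    * by rewrite ltrN2.
    * by move=> /strip_opp.
    exists d => // x x' y' c' Sx Sx' cc' xd yd cd kk.
    have [|||||||] := dP (- x) (- x') y' c'.
    * exact/strip_opp.
    * exact/strip_opp.
    * by apply/same_side_opp; rewrite /lin /= opprK.
    * by rewrite -opprD normrN.
    * exact: yd.
    * by rewrite /= opprK.
    * by rewrite !GE kk /lin /= !opprK.
    * by move=> h1; rewrite /leaf /= !opprK; split=> //; move: h1; rewrite -opprD normrN.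
  + case: Sb; rewrite bm => t; rewrite minxx maxxx -eq_le => /eqP <-; exact: sm.
Qed.

End Strips.

(** * Moving leaves inside the strips *)

Section StripBase.
Context {R : realType}.
Implicit Types (r s : R -> R) (m x : R).

Lemma strip_refl s m : s m != 0 -> strip s m m.
Proof. by move=> sm t; rewrite minxx maxxx -eq_le => /eqP <-. Qed.

Lemma strip_sym s m x : strip s m x -> strip s x m.
Proof. by move=> h t; rewrite minC maxC; exact: h. Qed.

Lemma strip_neq0 s m x : strip s m x -> s x != 0.
Proof. by move=> h; apply: h; rewrite ge_min le_max lexx !orbT. Qed.

Lemma strip_trans s m x x' : strip s m x -> strip s x x' -> strip s m x'.
Proof.
move=> mx xx' t; rewrite ge_min le_max => tP.
have [tx|xt] := leP t x.
- have [mt|tm] := leP m t.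
    by apply: mx; rewrite ge_min le_max mt tx orbT.
  have x't : x' <= t by move: tP; rewrite leNgt tm /= => /andP[].
  by apply: xx'; rewrite ge_min le_max x't tx orbT.
- have [mt|tm] := ltP m t.
    have tx' : t <= x' by move: tP => /andP[_]; rewrite leNgt mt.
    by apply: xx'; rewrite ge_min le_max (ltW xt) tx' orbT.
  by apply: mx; rewrite ge_min le_max (ltW xt) tm orbT.
Qed.

Lemma strip_eq s m x : strip s m x -> strip s m = strip s x.
Proof.
move=> mx; apply/seteqP; split=> t; apply: strip_trans => //.
exact: strip_sym.
Qed.

Lemma neq0_near s x : continuous s -> s x != 0 -> \forall t \near x, s t != 0.
Proof.
move=> cs sx; have /cvgrPdist_lt/(_ `|s x|) := cs x; rewrite normr_gt0 => /(_ sx).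
by apply: filterS => t; apply: contraTneq => ->; rewrite subr0 ltxx.
Qed.

Lemma strip_near s m x : continuous s -> strip s m x ->
  \forall t \near x, strip s m t.
Proof.
move=> cs Sx; have /near_realP[d d0 dP] := neq0_near cs (strip_neq0 Sx).
apply/near_realP; exists d => // t td; apply: strip_trans Sx _ => v.
rewrite ge_min le_max => vP; apply: dP; move: td vP.
rewrite !ltr_norml; case: (leP x v) => xv; case: (leP v x) => vx /=; lra.
Qed.

(** Points of one strip have equal sets [strip s x], so the choice depends on the strip only. *)
Definition base s x : R := xget 0 (strip s x).

Lemma baseP s x : s x != 0 -> strip s (base s x) x.
Proof.
by move=> sx; apply/strip_sym; rewrite /base; case: xgetP => // /(_ x) [];
  exact: strip_refl.
Qed.

Lemma base_eq s m x : strip s m x -> base s x = base s m.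
Proof. by move=> /strip_eq; rewrite /base => ->. Qed.

Lemma base_neq0 s x : s x != 0 -> s (base s x) != 0.
Proof. by move=> /baseP /strip_sym /strip_neq0. Qed.

End StripBase.

(** * The leaf shift: bijectivity and joint continuity *)

Section LeafShift.
Context {R : realType}.
Variables (r s : R -> R).
Hypotheses (cr : continuous r) (cs : continuous s).
Local Notation plane := (R * R)%type.
Implicit Types (z w : plane) (N : R -> R -> R).

Definition linear_like z : R := lin r s z.1 z.2.

Variable K : R -> R -> R -> R.
Hypothesis KP : forall m, s m != 0 -> strip_coord r s m (K m).

(** The conditions are premises of the relation, so that a choice function exists on all
    quadruples. *)
Let matching m x c c' x' := s m != 0 -> same_side r s c c' -> strip s m x ->
   strip s m x' /\ K m x' c' = K m x c.

Let matching_exists (q : R * R * R * R) :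
  exists x', matching q.1.1.1 q.1.1.2 q.1.2 q.2 x'.
Proof.
case: q => [[[m x] c] c'] /=; rewrite /matching.
have [[sm [cc' mx]]|h] := pselect (s m != 0 /\ same_side r s c c' /\ strip s m x).
  by have [_ _ /(_ _ _ _ cc' mx)[x' h1 h2] _] := KP sm; exists x'.
by exists 0 => h1 h2 h3; case: h.
Qed.

Let X : R * R * R * R -> R := projT1 (choice matching_exists).

Let XP m x c c' : matching m x c c' (X (m, x, c, c')).
Proof. exact: (projT2 (choice matching_exists)) (m, x, c, c'). Qed.

(* Moves each leaf of level [c] of the strip with base point [m] to the leaf of
   level [N m c] of that strip, and fixes the vertical leaves. *)
Definition leaf_shift N z : plane :=
  if s z.1 == 0 then z else
  let m := base s z.1 in let c' := N m (linear_like z) in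
  let x' := X (m, z.1, linear_like z, c') in (x', leaf r s c' x').

Definition preserves_sides N := forall m c, same_side r s c (N m c).

Lemma leaf_shift_vertical N z : s z.1 = 0 -> leaf_shift N z = z.
Proof. by move=> sz; rewrite /leaf_shift sz eqxx. Qed.

Section OneShift.
Variable N : R -> R -> R.
Hypothesis NP : preserves_sides N.

Lemma leaf_shift_match z : s z.1 != 0 ->
  strip s (base s z.1) (leaf_shift N z).1 /\
  K (base s z.1) (leaf_shift N z).1 (N (base s z.1) (linear_like z)) =
  K (base s z.1) z.1 (linear_like z).
Proof.
move=> sz; rewrite /leaf_shift (negbTE sz) /=.
by apply: XP => //; [exact: base_neq0|exact: baseP].
Qed.

Lemma leaf_shift_neq0 z : s z.1 != 0 -> s (leaf_shift N z).1 != 0.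
Proof. by move=> /leaf_shift_match [/strip_neq0]. Qed.

Lemma leaf_shift_zero z : (s (leaf_shift N z).1 == 0) = (s z.1 == 0).
Proof.
have [sz|sz] := boolP (s z.1 == 0); last exact/negbTE/leaf_shift_neq0.
by rewrite leaf_shift_vertical // (eqP sz).
Qed.

Lemma leaf_shift_base z : s z.1 != 0 ->
  base s (leaf_shift N z).1 = base s z.1.
Proof.
move=> sz; have [h _] := leaf_shift_match sz.
by rewrite (base_eq h) -(base_eq (baseP sz)).
Qed.

Lemma leaf_shift_snd z : s z.1 != 0 -> (leaf_shift N z).2 =
  leaf r s (N (base s z.1) (linear_like z)) (leaf_shift N z).1.
Proof. by move=> sz; rewrite /leaf_shift (negbTE sz). Qed.

Lemma linear_like_leaf_shift z : s z.1 != 0 ->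
  linear_like (leaf_shift N z) = N (base s z.1) (linear_like z).
Proof.
by move=> sz; rewrite /linear_like leaf_shift_snd // lin_leaf // leaf_shift_neq0.
Qed.

End OneShift.

Lemma strip_coord_inj m x x' c : s m != 0 -> strip s m x -> strip s m x' ->
  K m x c = K m x' c -> x = x'.
Proof.
move=> sm Sx Sx' kk; have [_ k2 _ _] := KP sm.
have [h|h|//] := ltgtP x x'.
  by have := k2 x x' c Sx Sx' h; rewrite kk ltxx.
by have := k2 x' x c Sx' Sx h; rewrite kk ltxx.
Qed.

Lemma linear_like_inj z w : z.1 = w.1 -> s z.1 != 0 ->
  linear_like z = linear_like w -> z = w.
Proof.
case: z w => [x y] [x' y'] /= <- sx E; congr pair.
by rewrite -(leaf_lin r y sx) -[RHS](leaf_lin r y' sx); congr leaf.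
Qed.

(** A point off the vertical leaves is recovered from its strip, its level and its coordinate along
    the leaf. *)
Lemma leaf_shift_inj N : preserves_sides N -> (forall m, injective (N m)) ->
  injective (leaf_shift N).
Proof.
move=> NP Ninj z w zw.
have sE : (s z.1 == 0) = (s w.1 == 0).
  by rewrite -(leaf_shift_zero NP z) zw leaf_shift_zero.
have [sz|sz] := boolP (s z.1 == 0).
  move: zw; rewrite !leaf_shift_vertical //; apply/eqP => //.
  by rewrite -sE.
have sw : s w.1 != 0 by rewrite -sE.
have bE : base s z.1 = base s w.1.
  by rewrite -(leaf_shift_base NP sz) zw leaf_shift_base.
have pE : linear_like z = linear_like w.
  by apply: (Ninj (base s z.1)); rewrite -linear_like_leaf_shift // zw
    linear_like_leaf_shift // bE.
apply: linear_like_inj => //.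
have [_ kz] := leaf_shift_match NP sz; have [_ kw] := leaf_shift_match NP sw.
apply: (@strip_coord_inj (base s z.1) _ _ (linear_like z)).
- exact: base_neq0.
- exact: baseP.
- by rewrite bE; exact: baseP.
by rewrite -kz zw pE bE.
Qed.

Lemma leaf_shift_cancel N N' : preserves_sides N -> preserves_sides N' ->
  (forall m, cancel (N m) (N' m)) -> cancel (leaf_shift N) (leaf_shift N').
Proof.
move=> NP NP' NK z; have [sz|sz] := boolP (s z.1 == 0).
  by rewrite !leaf_shift_vertical //; apply/eqP; rewrite ?leaf_shift_vertical //; exact/eqP.
have sz' := leaf_shift_neq0 NP sz; have sz'' := leaf_shift_neq0 NP' sz'.
have bE := leaf_shift_base NP sz.
have pE : linear_like (leaf_shift N' (leaf_shift N z)) = linear_like z.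
  by rewrite linear_like_leaf_shift // bE linear_like_leaf_shift // NK.
apply: linear_like_inj => //.
have [S1 kz] := leaf_shift_match NP sz.
have [S2 kz'] := leaf_shift_match NP' sz'.
rewrite bE in S2 kz'.
apply: (@strip_coord_inj (base s z.1) _ _ (linear_like z)) => //.
- exact: base_neq0.
- exact: baseP.
by rewrite -kz -[X in K _ _ X]pE linear_like_leaf_shift // bE kz' linear_like_leaf_shift.
Qed.

Lemma leaf_shift_id N : preserves_sides N -> (forall m c, N m c = c) ->
  leaf_shift N =1 id.
Proof.
move=> NP Nid z; have [sz|sz] := boolP (s z.1 == 0).
  by rewrite leaf_shift_vertical //; exact/eqP.
have [S1 kz] := leaf_shift_match NP sz.
apply: linear_like_inj; last by rewrite linear_like_leaf_shift // Nid.
  apply: (@strip_coord_inj (base s z.1) _ _ (linear_like z)) => //.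
  - exact: base_neq0.
  - exact: baseP.
  - by rewrite -kz Nid.
exact: leaf_shift_neq0.
Qed.

Hypothesis zeros_finite : finite_set [set x | s x = 0].

Lemma zero_isolated a : s a = 0 -> exists2 d : R, 0 < d &
  forall x, 0 < `|x - a| < d -> s x != 0.
Proof.
move=> sa; pose Z := [set x | s x = 0] `\ a.
have fZ : finite_set Z by apply: sub_finite_set zeros_finite => x [].
have cZ : closed Z by apply: compact_closed; [exact: Rhausdorff|exact: finite_compact].
have : nbhs a (~` Z).
  by apply: open_nbhs_nbhs; split; [exact: closed_openC|move=> [_]; exact].
move=> /near_realP[d d0 dP]; exists d => // x /andP[x0 xd].
apply/eqP => sx; apply: (dP x xd); split=> // xa.
by move: x0; rewrite xa subrr normr0 ltxx.
Qed.

(** On a vertical leaf, continuity is the last clause of [strip_coord], applied to the strip on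
    either side. Inside a strip, the partner depends continuously on the data because the coordinate
    is continuous and strictly monotone along each leaf. *)
Lemma continuous_leaf_shift (M : R -> R -> R -> R) :
  (forall t, preserves_sides (M t)) ->
  (forall m, continuous (fun tc : R * R => M tc.1 m tc.2)) ->
  continuous (fun q : R * plane => leaf_shift (M q.1) q.2).
Proof.
move=> MP cM [t0 z0].
have cpt : continuous linear_like by exact: continuous_lin.
have cptq q : {for q, continuous (fun q : R * plane => linear_like q.2)}.
  by apply: (@continuous_comp _ _ _ snd linear_like); [exact: cvg_snd|exact: cpt].
have c21 q : {for q, continuous (fun q : R * plane => q.2.1)}.
  by apply: (@for_fst _ _ _ (snd : R * plane -> plane)); exact: cvg_snd.
have c22 q : {for q, continuous (fun q : R * plane => q.2.2)}.
  by apply: (@for_snd _ _ _ (snd : R * plane -> plane)); exact: cvg_snd.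
have cMq m q : {for q, continuous (fun q : R * plane => M q.1 m (linear_like q.2))}.
  apply: (@for_comp2 _ _ _ _ fst (fun q : R * plane => linear_like q.2)
    (fun tc : R * R => M tc.1 m tc.2)); [exact: cvg_fst|exact: cptq|exact: cM].
have [/eqP sz0|sz0] := boolP (s z0.1 == 0).
- have [d1 d10 d1P] := zero_isolated sz0.
  set a := z0.1 in sz0 d1P *.
  have sm x : 0 < `|x - a| < d1 -> s x != 0 := @d1P x.
  (* Near [a] only the two adjacent strips occur, so the base point takes just these two values. *)
  pose ml := base s (a - d1 / 2); pose mr := base s (a + d1 / 2).
  have sl : s (a - d1 / 2) != 0.
    by apply: sm; rewrite addrAC subrr sub0r normrN gtr0_norm; lra.
  have sr : s (a + d1 / 2) != 0.
    by apply: sm; rewrite addrAC subrr add0r gtr0_norm; lra.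
  have bE x : s x != 0 -> `|x - a| < d1 -> base s x = ml \/ base s x = mr.
    rewrite ltr_norml => sx xd.
    have [xa|ax|xa] := ltgtP x a; last by rewrite xa sz0 eqxx in sx.
      left; apply: base_eq => t; rewrite ge_min le_max => tP.
      have ta : t < a by move: tP; case: (leP t (a - d1 / 2)); case: (leP t x) => /=; lra.
      apply: sm; rewrite ltr0_norm ?subr_lt0 //.
      move: tP; case: (leP (a - d1 / 2) t); case: (leP x t) => /=; lra.
    right; apply: base_eq => t; rewrite ge_min le_max => tP.
    have ta : a < t by move: tP; case: (leP (a + d1 / 2) t); case: (leP x t) => /=; lra.
    apply: sm; rewrite gtr0_norm ?subr_gt0 //.
    move: tP; case: (leP t (a + d1 / 2)); case: (leP t x) => /=; lra.
  have nS m : ~ strip s m a by move=> /strip_neq0; rewrite sz0 eqxx.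
  (* Keeping the level [r a] on its side of [r a] means fixing it; levels near [r a] therefore have
     images near [r a]. *)
  have Ma m : M t0 m (r a) = r a.
    have [h1 h2] := MP t0 m (r a) a sz0.
    by apply/eqP; rewrite eq_le !leNgt -h1 -h2 ltxx.
  have pta : linear_like z0 = r a by rewrite /linear_like /lin -/a sz0 mul0r addr0.
  have side m e : s m != 0 -> 0 < e -> \forall q \near (t0, z0),
      s q.2.1 != 0 -> base s q.2.1 = m ->
      `|(leaf_shift (M q.1) q.2).1 - a| < e /\
      `|(leaf_shift (M q.1) q.2).2 - z0.2| < e.
    move=> sm0 e0.
    have [_ _ _ /(_ a z0.2 e e0 (nS m))[d d0 dP]] := KP sm0.
    have n1 : \forall q \near (t0, z0), `|M q.1 m (linear_like q.2) - r a| < d.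
      have /cvgrPdist_lt/(_ d d0) /= := cMq m (t0, z0).
      by apply: filterS => q; rewrite pta Ma distrC.
    have n2 : \forall q \near (t0, z0), `|q.2.1 - a| < d.
      have /cvgrPdist_lt/(_ d d0) := c21 (t0, z0).
      by apply: filterS => q /=; rewrite distrC.
    have n3 : \forall q \near (t0, z0), `|q.2.2 - z0.2| < d.
      have /cvgrPdist_lt/(_ d d0) := c22 (t0, z0).
      by apply: filterS => q /=; rewrite distrC.
    near=> q => sq bq.
    have [S1 k1] := leaf_shift_match (MP q.1) sq; rewrite bq in S1 k1.
    rewrite (leaf_shift_snd _ sq) bq.
    apply: (dP q.2.1 _ q.2.2 _ _ S1) => //.
    - by rewrite -bq; exact: baseP.
    - exact: MP.
    - by near: q.
    - by near: q.
    - by near: q.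
  apply/cvgrPdist_lt => e e0.
  have n2 : \forall q \near (t0, z0), ball z0 e q.2.
    by apply: (@cvg_snd _ _ (nbhs t0) (nbhs z0) _); exact: nbhsx_ballx.
  have n1 : \forall q \near (t0, z0), `|q.2.1 - a| < d1.
    have /cvgrPdist_lt/(_ d1 d10) := c21 (t0, z0).
    by apply: filterS => q /=; rewrite distrC.
  have nl := side ml e (base_neq0 sl) e0.
  have nr := side mr e (base_neq0 sr) e0.
  rewrite /= (leaf_shift_vertical _ sz0).
  near=> q.
  have [/eqP sq|sq] := boolP (s q.2.1 == 0).
    rewrite (leaf_shift_vertical _ sq).
    have : ball z0 e q.2 by near: q.
    by rewrite -ball_normE.
  suff [h1 h2] : `|(leaf_shift (M q.1) q.2).1 - a| < e /\
      `|(leaf_shift (M q.1) q.2).2 - z0.2| < e.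
    have : ball z0 e (leaf_shift (M q.1) q.2) by split; rewrite /ball/= distrC.
    by rewrite -ball_normE.
  have [bq|bq] : base s q.2.1 = ml \/ base s q.2.1 = mr.
    by apply: bE => //; near: q.
  - by move: sq bq; near: q; exact: nl.
  - by move: sq bq; near: q; exact: nr.
- pose m := base s z0.1.
  have sm : s m != 0 by exact: base_neq0.
  have S0 : strip s m z0.1 by exact: baseP.
  have nS : \forall q \near (t0, z0), strip s m q.2.1.
    exact: (c21 (t0, z0) _ (strip_near cs S0)).
  have bq x : strip s m x -> base s x = m.
    by move=> Sx; rewrite (base_eq Sx) -(base_eq S0).
  pose x1 := (leaf_shift (M t0) z0).1.
  have [S1 k1] := leaf_shift_match (MP t0) sz0.
  rewrite -/m -/x1 in S1 k1.
  have [kc k2 _ _] := KP sm.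
  have cK1 x : strip s m x ->
    {for (t0, z0), continuous (fun q : R * plane => K m x (M q.1 m (linear_like q.2)))}.
    move=> Sx; apply: (@for_comp2 _ _ _ _ (fun=> x)
      (fun q : R * plane => M q.1 m (linear_like q.2))
      (fun w : R * R => K m w.1 w.2)).
    - exact: cvg_cst.
    - exact: cMq.
    - exact: kc.
  have cK0 : {for (t0, z0), continuous (fun q : R * plane => K m q.2.1 (linear_like q.2))}.
    apply: (@for_comp2 _ _ _ _ (fun q : R * plane => q.2.1)
      (fun q : R * plane => linear_like q.2) (fun w : R * R => K m w.1 w.2)).
    - exact: c21.
    - exact: cptq.
    - exact: kc.
  have c1 : {for (t0, z0), continuous (fun q : R * plane => (leaf_shift (M q.1) q.2).1)}.
    (* The partner is trapped between [x1 - e'] and [x1 + e']: the coordinates at these two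
       abscissas lie strictly below and above the required value, and this persists for nearby
       data. *)
    apply/cvgrPdist_lt => e e0; rewrite /= -/x1.
    have /near_realP[d d0 dP] := strip_near cs S1.
    pose e' := Num.min (d / 2) (e / 2).
    have e'0 : 0 < e' by rewrite lt_min !divr_gt0.
    have e'd : e' <= d / 2 by rewrite ge_min lexx.
    have e'e : e' <= e / 2 by rewrite ge_min lexx orbT.
    have Sl : strip s m (x1 - e').
      by apply: dP; rewrite addrAC subrr sub0r normrN gtr0_norm; lra.
    have Sr : strip s m (x1 + e').
      by apply: dP; rewrite addrAC subrr add0r gtr0_norm; lra.
    have n1 : \forall q \near (t0, z0),
        0 < K m q.2.1 (linear_like q.2) - K m (x1 - e') (M q.1 m (linear_like q.2)).
      have h : 0 < K m z0.1 (linear_like z0) - K m (x1 - e') (M t0 m (linear_like z0)).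
        by rewrite subr_gt0 -k1; apply: k2 => //; lra.
      exact: (cvgB cK0 (cK1 _ Sl) (lt_nbhsr h)).
    have n2 : \forall q \near (t0, z0),
        0 < K m (x1 + e') (M q.1 m (linear_like q.2)) - K m q.2.1 (linear_like q.2).
      have h : 0 < K m (x1 + e') (M t0 m (linear_like z0)) - K m z0.1 (linear_like z0).
        by rewrite subr_gt0 -k1; apply: k2 => //; lra.
      exact: (cvgB (cK1 _ Sr) cK0 (lt_nbhsr h)).
    near=> q.
    have Sq : strip s m q.2.1 by near: q.
    have sq := strip_neq0 Sq.
    have [S2 kq] := leaf_shift_match (MP q.1) sq.
    rewrite (bq _ Sq) in S2 kq.
    set x2 := (leaf_shift _ _).1 in S2 kq *.
    have l1 : x1 - e' < x2.
      rewrite ltNge le_eqVlt; apply/negP => /predU1P[h|h].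
        have : 0 < K m q.2.1 (linear_like q.2) - K m (x1 - e') (M q.1 m (linear_like q.2))
          by near: q.
        by rewrite -kq h subrr ltxx.
      have : 0 < K m q.2.1 (linear_like q.2) - K m (x1 - e') (M q.1 m (linear_like q.2))
          by near: q.
      rewrite subr_gt0 -kq => /lt_trans /(_ (k2 _ _ _ S2 Sl h)).
      by rewrite ltxx.
    have l2 : x2 < x1 + e'.
      rewrite ltNge le_eqVlt; apply/negP => /predU1P[h|h].
        have : 0 < K m (x1 + e') (M q.1 m (linear_like q.2)) -
          K m q.2.1 (linear_like q.2) by near: q.
        by rewrite -kq h subrr ltxx.
      have : 0 < K m (x1 + e') (M q.1 m (linear_like q.2)) -
          K m q.2.1 (linear_like q.2) by near: q.
      rewrite subr_gt0 -kq => /lt_trans /(_ (k2 _ _ _ Sr S2 h)).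
      by rewrite ltxx.
    by rewrite ltr_norml; apply/andP; split; lra.
  have c2 : {for (t0, z0), continuous (fun q : R * plane =>
      leaf r s (M q.1 m (linear_like q.2)) (leaf_shift (M q.1) q.2).1)}.
    apply: (@for_comp2 _ _ _ _ (fun q : R * plane => (leaf_shift (M q.1) q.2).1)
      (fun q : R * plane => M q.1 m (linear_like q.2))
      (fun w : R * R => leaf r s w.2 w.1)).
    - exact: c1.
    - exact: cMq.
    - apply: continuous_leaf => //; exact: leaf_shift_neq0.
  have E : \forall q \near (t0, z0), leaf_shift (M q.1) q.2 =
     ((leaf_shift (M q.1) q.2).1,
       leaf r s (M q.1 m (linear_like q.2)) (leaf_shift (M q.1) q.2).1).
    near=> q; have Sq : strip s m q.2.1 by near: q.
    rewrite -(bq _ Sq) -leaf_shift_snd ?(strip_neq0 Sq) //.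
    exact: surjective_pairing.
  have E0 := nbhs_singleton E.
  have := for_pair c1 c2; rewrite /prop_for /continuous_at /= => c3.
  rewrite /prop_for /continuous_at /= E0.
  by apply: cvg_trans c3; apply: near_eq_cvg; near=> q; near: q;
    apply: filterS E => q ->.
Unshelve. all: by end_near. Qed.

End LeafShift.

(** * Linear-like submersions *)

Section LinearLike.
Context {R : realType}.
Local Notation plane := (R * R)%type.
Implicit Types (r s f : R -> R) (p q : plane -> R).

Lemma deriv_gt0_incr f a : (forall x, derivable f x 1) ->
  continuous (derive1 f) -> 0 < derive1 f a ->
  exists2 d : R, 0 < d & forall x x', a - d < x -> x < x' -> x' < a + d -> f x < f x'.
Proof.
move=> df cdf fa; have /near_realP[d d0 dP] := cdf a _ (lt_nbhsr fa).
exists d => // x x' h1 h2 h3.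
apply: (@gtr0_derive1_lt_oo _ f (a - d) (a + d)) => //.
- by move=> t; rewrite in_itv/= => /andP[t1 t2]; apply: dP; rewrite ltr_norml; lra.
- move=> t _; exact/differentiable_continuous/derivable1_diffP.
- by rewrite in_itv/=; apply/andP; split; lra.
- by rewrite in_itv/=; apply/andP; split; lra.
Qed.

Lemma linear_like_regular p : finite_linear_like_submersion p ->
  exists r s, regular r s /\ p = linear_like r s.
Proof.
move=> [[r [s [sr ss fs pE]]] gp].
have ppt : p = linear_like r s by apply/funext => -[x y]; exact: pE.
have cdv f : smooth f -> continuous f.
  by move=> sf x; apply/differentiable_continuous/derivable1_diffP; exact: sf 0%N x.
exists r, s; split=> //; split; [exact: cdv|exact: cdv|exact: fs|].
have dr x : derivable r x 1 := sr 0%N x.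
have ds x : derivable s x 1 := ss 0%N x.
have cdr : continuous (derive1 r).
  by move=> x; apply/differentiable_continuous/derivable1_diffP; exact: sr 1%N x.
have cds : continuous (derive1 s).
  by move=> x; apply/differentiable_continuous/derivable1_diffP; exact: ss 1%N x.
have dlin (y x : R) : is_derive x (1 : R)
    (fun t : R => lin r s t y) (derive1 r x + derive1 s x * y).
  have hr : is_derive x 1 r (derive1 r x) by rewrite derive1E; exact: DeriveDef.
  have hs : is_derive x 1 s (derive1 s x) by rewrite derive1E; exact: DeriveDef.
  apply: is_deriveD; apply: is_derive_eq.
  by rewrite scaler0 add0r mulrC.
have dlv (y x : R) : 'D_(1 : R) (fun t : R => lin r s t y) x =
    derive1 r x + derive1 s x * y.
  by have h := dlin y x; exact: derive_val.
move=> a sa.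
have nz y : derive1 r a + derive1 s a * y != 0.
  have := gp (a, y); apply: contraNneq => d0; rewrite /gradient xpair_eqE.
  apply/andP; split; apply/eqP.
    rewrite -[RHS]d0 -dlv /derive; apply: (congr1 (fun g : R -> R => lim (g @ 0^'))).
    apply/funext => h; rewrite ppt /linear_like /=.
    by rewrite /GRing.scale/= mulr1 mulr0 add0r.
  transitivity ('D_(1 : R^o) (fun=> r a : R^o) (0 : R^o)); last exact: derive_cst.
  rewrite /derive.
  apply: (congr1 (fun g : R -> R => lim (g @ 0^'))).
  apply/funext => h; rewrite ppt /linear_like /lin /=.
  by rewrite /GRing.scale/= mulr0 add0r sa !mul0r !addr0.
(* At a zero of [s] the [x]-derivative is affine in [y] and, by the gradient condition, has no zero;
   so its slope vanishes. *)
have sa1 : derive1 s a = 0.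
  apply/eqP; apply/negP => /negP sa1.
  have := nz (- derive1 r a / derive1 s a).
  by rewrite mulrC divfK // subrr eqxx.
have ra1 : derive1 r a != 0 by have := nz 0; rewrite mulr0 addr0.
have cdl y : continuous (derive1 (fun t : R => lin r s t y)).
  rewrite (_ : derive1 _ = fun x => derive1 r x + derive1 s x * y).
    move=> x; apply: cvgD; first exact: cdr.
    by apply: cvgM; [exact: cds|exact: cvg_cst].
  by apply/funext => x; rewrite derive1E dlv.
have dl (y x : R) : derivable (fun t : R => lin r s t y) x (1 : R).
  by have h := dlin y x; exact: ex_derive.
have dla y : derive1 (fun t : R => lin r s t y) a = derive1 r a.
  by rewrite derive1E dlv sa1 mul0r addr0.
have [r0|r0|r0] := ltgtP (derive1 r a) 0; last by rewrite r0 eqxx in ra1.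
- right=> y.
  have [|||d d0 dP] := @deriv_gt0_incr (fun t => - lin r s t y) a.
  + by move=> x; exact: derivableN.
  + rewrite (_ : derive1 _ = fun x => - derive1 (fun t : R => lin r s t y) x).
      by move=> x; apply: cvgN; exact: cdl.
    by apply/funext => x; rewrite !derive1E deriveN.
  + by rewrite derive1E deriveN // -derive1E dla oppr_gt0.
  by exists d => // x x' h1 h2 h3; rewrite -ltrN2; exact: dP.
- left=> y; apply: deriv_gt0_incr; [exact: dl|exact: cdl|by rewrite dla].
Qed.

Lemma regular_opp r s : regular r s -> regular (fun x => - r x) (fun x => - s x).
Proof.
move=> [cr cs fs tr]; split.
- by move=> x; apply: cvgN; exact: cr.
- by move=> x; apply: cvgN; exact: cs.
- by apply: sub_finite_set fs => x /= /eqP; rewrite oppr_eq0 => /eqP.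
move=> a /eqP; rewrite oppr_eq0 => /eqP sa.
have [inc|dec] := tr a sa; [right|left] => y.
  have [d d0 dP] := inc y; exists d => // x x' h1 h2 h3.
  by have := dP x x' h1 h2 h3; rewrite /lin !mulNr -!opprD ltrN2.
have [d d0 dP] := dec y; exists d => // x x' h1 h2 h3.
by have := dP x x' h1 h2 h3; rewrite /lin !mulNr -!opprD ltrN2.
Qed.

(** Where [s] is nonzero a vertical move changes the level in both directions; at a zero of [s] a
    horizontal move does, by transversality. *)
Lemma linear_like_no_extremum r s z (P : plane -> Prop) : transverse r s ->
  (\forall w \near z, P w) ->
  (exists2 w, P w & linear_like r s z < linear_like r s w) /\
  (exists2 w, P w & linear_like r s w < linear_like r s z).
Proof.
move=> tr /near_planeP[e e0 eP]; case: z eP => x y /= eP.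
have P1 t : `|t - x| < e -> P (t, y) by move=> h; apply: eP; rewrite // subrr normr0.
have P2 t : `|t - y| < e -> P (x, t) by move=> h; apply: eP; rewrite // subrr normr0.
have P2' d : `|d| = e / 2 -> P (x, y + d).
  by move=> h; apply: P2; rewrite addrAC subrr add0r h; lra.
have e2 : `|e / 2| = e / 2 by rewrite gtr0_norm // divr_gt0.
have e2' : `|- (e / 2)| = e / 2 by rewrite normrN.
have ptE d : linear_like r s (x, y + d) = linear_like r s (x, y) + s x * d.
  by rewrite /linear_like /lin /= mulrDr addrA.
have [sx|sx|sx] := ltgtP (s x) 0.
- have h : s x * (e / 2) < 0 by rewrite nmulr_rlt0 // divr_gt0.
  split; [exists (x, y - e / 2)|exists (x, y + e / 2)]; try exact: P2';
    rewrite ptE ?mulrN; lra.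
- have h : 0 < s x * (e / 2) by rewrite mulr_gt0 // divr_gt0.
  split; [exists (x, y + e / 2)|exists (x, y - e / 2)]; try exact: P2';
    rewrite ptE ?mulrN; lra.
have Pd d : 0 < d -> exists v, [/\ 0 < v, v < d, P (x + v, y) & P (x - v, y)].
  move=> d0; exists (Num.min (d / 2) (e / 2)).
  have m0 : 0 < Num.min (d / 2) (e / 2) by rewrite lt_min !divr_gt0.
  have me : Num.min (d / 2) (e / 2) <= e / 2 by rewrite ge_min lexx orbT.
  split=> //; first by rewrite gt_min; apply/orP; left; lra.
    by apply: P1; rewrite addrAC subrr add0r gtr0_norm //; lra.
  by apply: P1; rewrite addrAC subrr add0r normrN gtr0_norm //; lra.
have [inc|dec] := tr x sx.
- have [d d0 dP] := inc y; have [v [v0 vd p1 p2]] := Pd d d0.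
  by split; [exists (x + v, y)|exists (x - v, y)] => //; apply: dP => /=; lra.
- have [d d0 dP] := dec y; have [v [v0 vd p1 p2]] := Pd d d0.
  by split; [exists (x - v, y)|exists (x + v, y)] => //; apply: dP => /=; lra.
Qed.

Lemma is_interval_strip s m : is_interval (strip s m).
Proof.
move=> x x' Sx Sx' t /andP[xt tx'] v; rewrite ge_min le_max => vP.
have [mt|tm] := leP m t.
  apply: Sx'; rewrite ge_min le_max.
  by move: vP; case: (leP m v); case: (leP v m); case: (leP t v); case: (leP v t);
    case: (leP x' v); case: (leP v x') => //=; lra.
apply: Sx; rewrite ge_min le_max.
by move: vP; case: (leP m v); case: (leP v m); case: (leP t v); case: (leP v t);
  case: (leP x v); case: (leP v x) => //=; lra.
Qed.

Lemma leaf_connected r s m c : continuous r -> continuous s ->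
  connected ((fun x => (x, leaf r s c x)) @` strip s m).
Proof.
move=> cr cs; apply: connected_continuous_connected.
  exact/connected_intervalP/is_interval_strip.
apply: continuous_in_subspaceT => x; rewrite inE => /strip_neq0 sx.
apply: for_pair; first exact: cvg_id.
apply: (@for_comp2 _ _ _ _ id (fun=> c) (fun w : R * R => leaf r s w.2 w.1)).
- exact: cvg_id.
- exact: cvg_cst.
- exact: continuous_leaf.
Qed.

(** Without local extrema a continuous function is injective, hence strictly monotone; the pair
    [c1], [c2] selects the direction. *)
Lemma no_extremum_increasing f (c1 c2 : R) : continuous f ->
  (forall x d, 0 < d -> (exists2 y, `|y - x| < d & f x < f y) /\
                        (exists2 y, `|y - x| < d & f y < f x)) ->
  c1 < c2 -> f c1 < f c2 -> {homo f : x y / x < y}.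
Proof.
move=> cf nex c12 f12.
have nint a b c : c \in `[a, b] -> c != a -> c != b ->
   ~ (forall t, t \in `[a, b] -> f t <= f c) /\
   ~ (forall t, t \in `[a, b] -> f c <= f t).
  rewrite in_itv/= => /andP[ac cb] ca cb'.
  have d0 : 0 < Num.min (c - a) (b - c).
    by rewrite lt_min !subr_gt0 !lt_neqAle ac cb eq_sym ca cb'.
  have [[y yd fy] [y' y'd fy']] := nex c _ d0.
  split=> h.
    have : y \in `[a, b] by move: yd; rewrite in_itv/= lt_min !ltr_norml; lra.
    by move=> /h; rewrite leNgt fy.
  have : y' \in `[a, b] by move: y'd; rewrite in_itv/= lt_min !ltr_norml; lra.
  by move=> /h; rewrite leNgt fy'.
(* With equal values at the ends, maximum and minimum on the interval are both this value, so the
   midpoint would be an extremum. *)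
have ninj x y : x < y -> f x <> f y.
  move=> xy fxy.
  have cfw : {within `[x, y], continuous f} by exact: continuous_withinT.
  have [cM cMI cMP] := EVT_max (ltW xy) cfw.
  have [cm cmI cmP] := EVT_min (ltW xy) cfw.
  have xI : x \in `[x, y] by rewrite in_itv/= lexx ltW.
  have yI : y \in `[x, y] by rewrite in_itv/= lexx ltW.
  have fM : f cM = f x.
    have [->//|h1] := eqVneq cM x; have [->//|h2] := eqVneq cM y.
    by have [] := nint x y cM cMI h1 h2.
  have fm : f cm = f x.
    have [->//|h1] := eqVneq cm x; have [->//|h2] := eqVneq cm y.
    by have [_ []] := nint x y cm cmI h1 h2.
  have mI : (x + y) / 2 \in `[x, y] by rewrite in_itv/=; apply/andP; split; lra.
  have [] := nint x y _ mI.
  - by rewrite gt_eqF //; lra.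
  - by rewrite lt_eqF //; lra.
  move=> + _; apply=> t /cMP; rewrite fM -fm => /le_trans; apply; exact: cmP.
have inj : {in `]-oo, +oo[ &, injective f}.
  move=> x y _ _ fxy; have [h|h|//] := ltgtP x y; first by have := ninj _ _ h.
  by have := ninj _ _ h; rewrite fxy.
have cfI : {within [set` `]-oo, +oo[], continuous f} by exact: continuous_withinT.
have [h x y xy|h] := itv_continuous_inj_mono cfI inj.
  by apply: h; rewrite ?in_itv.
have := h c2 c1; rewrite !in_itv /= => /(_ isT isT c12) /lt_trans /(_ f12).
by rewrite ltxx.
Qed.

End LinearLike.

(** * The level map of a leafwise map *)

Section LeafMaps.
Context {R : realType}.
Local Notation plane := (R * R)%type.
Implicit Types (r s f : R -> R) (p q : plane -> R) (h : plane -> plane).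

(** Stated for connected subsets of level sets, so that it applies to a graph leaf without proving
    that the graph is a whole component. *)
Definition leafwise p q h := forall C : set plane, connected C ->
  (forall z w, C z -> C w -> p z = p w) ->
  forall z w, C z -> C w -> q (h z) = q (h w).

Lemma leafwise_equivalence p q h :
  (forall L, level_foliation p L -> level_foliation q (h @` L)) ->
  leafwise p q h.
Proof.
move=> hL C cC Cp z w Cz Cw.
have [|z' Lz'] := hL (connected_component (p @^-1` [set p z]) z); first by exists z.
have CL : C `<=` connected_component (p @^-1` [set p z]) z.
  by apply: connected_component_max => // v Cv; exact: Cp.
have hq v : C v -> q (h v) = q z'.
  move=> /CL Lv; have : (h @` connected_component (p @^-1` [set p z]) z) (h v).
    by exists v.
  by rewrite Lz' => /connected_component_sub.
by rewrite !hq.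
Qed.

(** The image of the leaf of [p] through [hi z] is a leaf of [q] containing [z], hence the whole
    leaf through [z]. *)
Lemma leafwise_inverse p q h hi :
  cancel h hi -> cancel hi h ->
  (forall L, level_foliation p L -> level_foliation q (h @` L)) ->
  leafwise q p hi.
Proof.
move=> hK hiK hL C cC Cq z w Cz Cw.
pose L := connected_component (p @^-1` [set p (hi z)]) (hi z).
have [|z' Lz'] := hL L; first by exists (hi z).
have hz : connected_component (q @^-1` [set q z']) z' z.
  by rewrite -Lz'; exists (hi z); [exact: connected_component_refl|exact: hiK].
have qz : q z = q z' by move/connected_component_sub: hz.
have CL : C `<=` h @` L.
  rewrite Lz' (same_connected_component hz).
  by apply: connected_component_max => // v Cv; rewrite /= -qz; exact: Cq.
have hp v : C v -> p (hi v) = p (hi z).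
  by move=> /CL[u /connected_component_sub Lu <-]; rewrite hK.
by rewrite !hp.
Qed.

Section LevelMap.
Variables (r s : R -> R) (q : plane -> R) (h : plane -> plane).
Hypotheses (cr : continuous r) (cs : continuous s).
Hypotheses (cq : continuous q) (ch : continuous h).
Hypothesis hleaf : leafwise (linear_like r s) q h.

(* [q \o h] on the leaf of level [c] in the strip with base point [m]. *)
Definition level_map m c : R := q (h (m, leaf r s c m)).

Lemma level_mapE m z : strip s m z.1 -> q (h z) = level_map m (linear_like r s z).
Proof.
move=> Sz; set c := linear_like r s z.
have sm : s m != 0 by exact/strip_neq0/strip_sym/Sz.
have Cp : forall u v, ((fun x => (x, leaf r s c x)) @` strip s m) u ->
    ((fun x => (x, leaf r s c x)) @` strip s m) v -> linear_like r s u = linear_like r s v.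
  move=> _ _ [x Sx <-] [x' Sx' <-]; rewrite /linear_like /= !lin_leaf //.
    exact: strip_neq0 Sx'.
  exact: strip_neq0 Sx.
rewrite /level_map; apply: (hleaf (@leaf_connected _ r s m c cr cs) Cp).
- exists z.1 => //; case: z @c Cp Sz => x y /= _ Sz.
  by rewrite /linear_like leaf_lin //; exact: strip_neq0 Sz.
- by exists m => //; exact: strip_refl.
Qed.

Lemma continuous_level_map m : s m != 0 -> continuous (level_map m).
Proof.
move=> sm c; apply: (@continuous_comp _ _ _ (fun c => h (m, leaf r s c m)) q); last exact: cq.
apply: (@continuous_comp _ _ _ (fun c => (m, leaf r s c m)) h); last exact: ch.
apply: for_pair; first exact: cvg_cst.
apply: (@for_comp2 _ _ _ _ (fun=> m) id (fun w : R * R => leaf r s w.2 w.1)).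
- exact: cvg_cst.
- exact: cvg_id.
- exact: continuous_leaf.
Qed.

End LevelMap.

(** * Monotonicity and unboundedness of the level maps *)

Section LevelMapIncreasing.
Variables (r s r' s' : R -> R) (h hi : plane -> plane).
Hypotheses (reg : regular r s) (reg' : regular r' s').
Hypotheses (ch : continuous h) (chi : continuous hi).
Hypotheses (hK : cancel h hi) (hiK : cancel hi h).
Let p := linear_like r s.
Let q := linear_like r' s'.
Hypothesis hleaf : leafwise p q h.
Hypothesis hileaf : leafwise q p hi.

Let lam := level_map r s q h.

Let cr : continuous r. Proof. by case: reg. Qed.
Let cs : continuous s. Proof. by case: reg. Qed.
Let cp : continuous p. Proof. exact: continuous_lin. Qed.
Let cq : continuous q. Proof. by case: reg' => ? ? _ _; exact: continuous_lin. Qed.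

(** Near [h z] the inverse lands in the strip at levels close to [c]. There [q] takes values above
    and below [q (h z)], and these are values of [lam m] at levels close to [c]. *)
Lemma level_map_increasing m c1 c2 : s m != 0 -> c1 < c2 ->
  lam m c1 < lam m c2 -> {homo lam m : x y / x < y}.
Proof.
move=> sm; apply: no_extremum_increasing.
  by apply: continuous_level_map => //; exact: cs.
move=> c d d0; pose z := (m, leaf r s c m).
pose P w := `|p (hi w) - c| < d /\ strip s m (hi w).1.
have pz : p z = c by rewrite /p /linear_like /= lin_leaf.
have nP : \forall w \near h z, P w.
  have hz : hi (h z) = z by exact: hK.
  have n1 : \forall w \near z, `|p w - c| < d.
    have /cvgrPdist_lt/(_ d d0) := @cp z; rewrite pz.
    by apply: filterS => w; rewrite distrC.
  have n2 : \forall w \near z, strip s m w.1.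
    have := strip_near cs (strip_refl sm).
    exact: (@cvg_fst _ _ (nbhs m) (nbhs z.2) _).
  have nz : nbhs (hi (h z)) [set w | `|p w - c| < d /\ strip s m w.1].
    by rewrite hz; exact: (filterI n1 n2).
  exact: (@chi (h z) _ nz).
have tr' : transverse r' s' by case: reg'.
have [[w [pw Sw] qw] [w' [pw' Sw'] qw']] := linear_like_no_extremum tr' nP.
have lamE v : strip s m (hi v).1 -> lam m (p (hi v)) = q v.
  by move=> Sv; rewrite -[in RHS](hiK v); exact/esym/(level_mapE cr cs hleaf).
have lamz : lam m c = q (h z) by [].
split; [exists (p (hi w))|exists (p (hi w'))] => //.
- by rewrite lamE // lamz.
- by rewrite lamE // lamz.
Qed.

(* If the levels of the image leaves stayed below [d], these leaves would
   accumulate on a leaf of level [d], where [p \o hi] would be infinite. *)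
Lemma level_map_unbounded m v : s m != 0 -> {homo lam m : x y / x < y} ->
  exists c, v < lam m c.
Proof.
move=> sm inc; apply: contrapT => /forallNP bnd.
have hS : has_sup (range (lam m)).
  split; first by exists (lam m 0), 0.
  by exists v => _ [c _ <-]; rewrite leNgt; apply/negP/bnd.
set d := sup (range (lam m)) in hS.
pose w c := h (m, leaf r s c m).
have cw : continuous (fun c => (w c).1).
  move=> c; apply: for_fst.
  apply: (@continuous_comp _ _ _ (fun c => (m, leaf r s c m)) h); last exact: ch.
  apply: for_pair; first exact: cvg_cst.
  apply: (@for_comp2 _ _ _ _ (fun=> m) id (fun w : R * R => leaf r s w.2 w.1)).
  - exact: cvg_cst.
  - exact: cvg_id.
  - exact: continuous_leaf.
have lam_inj : injective (lam m).
  by move=> x y; have [/inc|/inc|//] := ltgtP x y; [move=> + E|move=> + E]; rewrite E ltxx.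
(* A point on a vertical leaf of [q] has one of finitely many levels and [lam m] is injective, so
   [w c] meets vertical leaves for finitely many [c] only. *)
have [C CP] : exists C, forall c, C < c -> s' (w c).1 != 0.
  have fZ : finite_set (r' @` [set x | s' x = 0]).
    by apply: finite_image; case: reg'.
  have := finite_preimage (f := lam m) (in2W lam_inj) fZ.
  move=> /finite_compact/compact_bounded[M [_ MP]].
  exists (Num.max 0 (M + 1)) => c; rewrite gt_max => /andP[c0 cM].
  apply/eqP => swc.
  have : `|c| <= M + 1.
    apply: MP; first by rewrite ltrDl.
    by exists (w c).1 => //; rewrite /lam /level_map -/(w c) /q /linear_like /lin swc mul0r addr0.
  by rewrite gtr0_norm // leNgt cM.
pose m' := (w (C + 1)).1.
(* The path [w] can change strips only by crossing a vertical leaf, so it stays in one strip of [q]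
   beyond [C]. *)
have Sw c : C < c -> strip s' m' (w c).1.
  move=> cC t tP; have C1 : C < C + 1 by rewrite ltrDl.
  have E a b : a <= b -> C < a ->
      Num.min (w a).1 (w b).1 <= t <= Num.max (w a).1 (w b).1 -> s' t != 0.
    move=> ab Ca tab; have [] := IVT (f := fun c => (w c).1) ab _ tab.
      exact: continuous_withinT.
    by move=> u; rewrite in_itv/= => /andP[au _] <-; apply: CP; exact: lt_le_trans au.
  have [h1|h1] := leP (C + 1) c; first exact: (E _ _ h1).
  by apply: (E c (C + 1)) => //; [exact: ltW|rewrite minC maxC].
have sm' : s' m' != 0 by apply: CP; rewrite ltrDl.
have [cr' cs' _ _] := reg'.
(* The level map of the inverse on this last strip of [q]: it undoes [lam m] at levels above [C],
   and it is continuous, hence bounded near [d]. *)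
pose lam' := level_map r' s' p hi.
have lamK c : C < c -> lam' m' (lam m c) = c.
  move=> cC; have := level_mapE cr' cs' hileaf (z := w c) (Sw _ cC).
  rewrite -/lam' => E; rewrite /lam /level_map -/(w c) -/q.
  by rewrite -[q (w c)]/(linear_like r' s' (w c)) -E /w hK /p /linear_like /= lin_leaf.
have clam' : continuous (lam' m') by apply: continuous_level_map.
have /cvgrPdist_lt/(_ 1 ltr01)/near_realP[e e0 eP] := clam' d.
have [_ [c0 _ <-] c0d] := sup_adherent e0 hS; rewrite -/d in c0d.
(* Then [lam m c] lies within [e] of [d], but [lam'] maps it to [c], which is at least
   [lam' m' d + 1]. *)
pose c := Num.max c0 (Num.max (C + 1) (lam' m' d + 1)).
have c0c : c0 <= c by rewrite le_max lexx.
have Cc : C < c.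
  by rewrite (@lt_le_trans _ _ (C + 1)) ?ltrDl // !le_max lexx orbT.
have dc : lam' m' d + 1 <= c by rewrite !le_max lexx !orbT.
have lc : lam m c0 <= lam m c.
  by move: c0c; rewrite le_eqVlt => /predU1P[->//|/inc/ltW].
have ld : lam m c <= d by apply: ub_le_sup; [case: hS|exists c].
have := eP (lam m c); rewrite lamK // => /(_ _).
have -> : `|lam m c - d| < e by rewrite ltr_norml; lra.
move=> /(_ isT); rewrite ltr_norml; lra.
Qed.

End LevelMapIncreasing.

Section LevelMapBijective.
Variables (r s r' s' : R -> R) (h hi : plane -> plane).
Hypotheses (reg : regular r s) (reg' : regular r' s').
Hypotheses (ch : continuous h) (chi : continuous hi).
Hypotheses (hK : cancel h hi) (hiK : cancel hi h).
Let p := linear_like r s.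
Let q := linear_like r' s'.
Hypothesis hleaf : leafwise p q h.
Hypothesis hileaf : leafwise q p hi.

Let lam := level_map r s q h.

Lemma linear_like_opp (a b : R -> R) z :
  linear_like (fun x => - a x) (fun x => - b x) z = - linear_like a b z.
Proof. by rewrite /linear_like /lin mulNr -opprD. Qed.

Lemma leaf_opp (a b : R -> R) c x :
  leaf (fun x => - a x) (fun x => - b x) c x = leaf a b (- c) x.
Proof. by rewrite /leaf invrN mulrN -mulNr opprD opprK. Qed.

Lemma leafwise_opp (f1 f2 : plane -> R) g : leafwise f1 f2 g ->
  leafwise (fun z => - f1 z) (fun z => - f2 z) g.
Proof.
move=> H C cC C1 z w Cz Cw; congr (- _).
by apply: (H C cC _ z w Cz Cw) => z1 w1 h1 h2; apply: oppr_inj; exact: C1.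
Qed.

(** Unboundedness below is unboundedness above for [- p] and [- q], whose level maps are conjugate
    to [lam] by the sign; the intermediate value theorem does the rest. *)
Lemma level_map_surjective m v : s m != 0 -> {homo lam m : x y / x < y} ->
  exists c, lam m c = v.
Proof.
move=> sm inc.
have [cr cs _ _] := reg; have [cr' cs' _ _] := reg'.
have cq : continuous q by exact: continuous_lin.
have [c2 c2P] := level_map_unbounded reg reg' ch chi hK hileaf v sm inc.
have [c1 c1P] : exists c, lam m c < v.
  have E1 : linear_like (fun x => - r x) (fun x => - s x) = fun z => - p z.
    by apply/funext => z; rewrite linear_like_opp.
  have E2 : linear_like (fun x => - r' x) (fun x => - s' x) = fun z => - q z.
    by apply/funext => z; rewrite linear_like_opp.
  have h2 := leafwise_opp hileaf.
  rewrite -E1 -E2 in h2.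
  have smN : - s m != 0 by rewrite oppr_eq0.
  have lamE c : level_map (fun x => - r x) (fun x => - s x)
      (linear_like (fun x => - r' x) (fun x => - s' x)) h m c = - lam m (- c).
    by rewrite /level_map linear_like_opp leaf_opp.
  have [|c cP] := level_map_unbounded (regular_opp reg) (regular_opp reg') ch chi hK
     h2 (- v) smN.
    by move=> x y xy; rewrite !lamE ltrN2; apply: inc; rewrite ltrN2.
  by exists (- c); move: cP; rewrite lamE ltrN2.
have c12 : c1 <= c2.
  rewrite leNgt; apply/negP => /inc /lt_trans /(_ c1P) /lt_trans /(_ c2P).
  by rewrite ltxx.
have [||c _ cP] := IVT (f := lam m) (v := v) c12.
- exact/continuous_withinT/continuous_level_map.
- by rewrite ge_min (ltW c1P) le_max (ltW c2P) orbT.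
by exists c.
Qed.

End LevelMapBijective.
End LeafMaps.

(** * Bifurcation values *)

Section SubtypeMap.
Context {X Y : topologicalType} (A : set X) (B : set Y) (h : X -> Y).
Hypothesis hAB : forall x, A x -> B (h x).

Definition sub_map (x : A) : B :=
  exist (fun y => y \in B) (h (val x)) (mem_set (hAB (set_valP x))).

Lemma continuous_sub_map : continuous h -> continuous sub_map.
Proof.
move=> ch; apply: (@continuous_comp_initial B A Y set_val).
move=> x; apply: (@continuous_comp _ _ _ (set_val : A -> X) h).
  exact: initial_continuous.
exact: ch.
Qed.

End SubtypeMap.

(** The fibre is kept; [h] transports the total space and [l] the neighbourhood in the base. *)
Lemma locally_trivial_conj (X Y X' Y' : topologicalType) (f : X -> Y)
    (g : X' -> Y') (h : X -> X') (l : Y -> Y') (y : Y) :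
  homeomorphism h -> homeomorphism l -> (forall x, l (f x) = g (h x)) ->
  locally_trivial_at f y -> locally_trivial_at g (l y).
Proof.
move=> [hi [ch chi hK hiK]] [li [cl cli lK liK]] lf [U [yU [F [phi [phom phiE]]]]].
have [psi [cphi cpsi phiK psiK]] := phom.
pose U' := li @^-1` U.
exists U'; split; first by apply: cli; rewrite lK.
have UU' u : U u -> U' (l u) by rewrite /U' /= lK.
have U'U u : U' u -> U (li u) by [].
have AA' x : (f @^-1` U) x -> (g @^-1` U') (h x) by rewrite /U' /= -lf lK.
have A'A x : (g @^-1` U') x -> (f @^-1` U) (hi x).
  by rewrite /U' /= -{1}(hiK x) -lf lK.
exists F, (fun w => sub_map AA' (phi (w.1, sub_map U'U w.2))); split; last first.
  move=> w; apply: val_inj => /=.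
  have := congr1 val (phiE (w.1, sub_map U'U w.2)) => /= E.
  by rewrite -lf E liK.
exists (fun z => let w := psi (sub_map A'A z) in (w.1, sub_map UU' w.2)); split.
- move=> w; apply: (@continuous_comp _ _ _ (fun w : F * U' => phi (w.1, sub_map U'U w.2))
    (sub_map AA')); last exact: continuous_sub_map.
  apply: (@continuous_comp _ _ _ (fun w : F * U' => (w.1, sub_map U'U w.2)) phi);
    last exact: cphi.
  apply: for_pair; first exact: cvg_fst.
  apply: (@continuous_comp _ _ _ snd (sub_map U'U)); first exact: cvg_snd.
  exact: continuous_sub_map.
- move=> z.
  have c1 : {for z, continuous (fun z => psi (sub_map A'A z))}.
    by apply: (@continuous_comp _ _ _ (sub_map A'A) psi);
      [exact: continuous_sub_map|exact: cpsi].
  apply: (@for_pair _ _ _ (fun z => (psi (sub_map A'A z)).1)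
    (fun z => sub_map UU' (psi (sub_map A'A z)).2)); first exact: for_fst c1.
  apply: (@continuous_comp _ _ _ (fun z => (psi (sub_map A'A z)).2) (sub_map UU')).
    exact: for_snd c1.
  exact: continuous_sub_map.
- move=> [w u] /=.
  rewrite (_ : sub_map A'A _ = phi (w, sub_map U'U u)); last first.
    by apply: val_inj => /=; rewrite hK.
  rewrite phiK /=; congr pair; apply: val_inj => /=; exact: liK.
- move=> z /=; apply: val_inj => /=.
  rewrite (_ : sub_map U'U _ = (psi (sub_map A'A z)).2); last first.
    by apply: val_inj => /=; exact: lK.
  by rewrite -surjective_pairing psiK /= hiK.
Qed.

Section Bifurcation.
Context {R : realType}.
Local Notation plane := (R * R)%type.

Lemma bifurcation_conj (f g : plane -> R) (h : plane -> plane) (l : R -> R) y :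
  homeomorphism h -> homeomorphism l -> (forall x, l (f x) = g (h x)) ->
  bifurcation_set g (l y) <-> bifurcation_set f y.
Proof.
move=> hh hl lf; split; apply: contra_not; first exact: locally_trivial_conj lf.
have [hi [ch chi hK hiK]] := hh; have [li [cl cli lK liK]] := hl.
move=> H; rewrite -(lK y).
apply: (@locally_trivial_conj _ _ _ _ g f hi li) => //.
- by exists h.
- by exists l.
- by move=> x; apply: (can_inj lK); rewrite lf hiK liK.
Qed.

(** A level is affine in the height, so near [(a, y)] it lies between the levels at heights [y - 1]
    and [y + 1]; by transversality both are on the same strict side of [r a] when the abscissa is
    not [a]. *)
Lemma vertical_isolated (r s : R -> R) (a y : R) : transverse r s -> s a = 0 ->
  \forall w \near (a, y), linear_like r s w = r a -> w.1 = a.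
Proof.
move=> tr sa; have lina y' : lin r s a y' = r a by rewrite /lin sa mul0r addr0.
have between x y' : `|y' - y| < 1 ->
    Num.min (lin r s x (y - 1)) (lin r s x (y + 1)) <= lin r s x y' <=
    Num.max (lin r s x (y - 1)) (lin r s x (y + 1)).
  rewrite ltr_norml /lin ge_min le_max !lerD2l => yy.
  have [sx|sx] := leP 0 (s x).
    by apply/andP; split; apply/orP; [left|right]; apply: ler_wpM2l => //; lra.
  by apply/andP; split; apply/orP; [right|left]; apply: ler_wnM2l; rewrite ?ltW //; lra.
apply/near_planeP; have [inc|dec] := tr a sa.
- have [d1 d10 d1P] := inc (y - 1); have [d2 d20 d2P] := inc (y + 1).
  exists (Num.min 1 (Num.min d1 d2)) => [|x y' /=]; first by rewrite !lt_min ltr01 d10.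
  rewrite !lt_min => /andP[_ /andP[x1 x2]] /andP[/(between x) /andP[b1 b2] _].
  rewrite /linear_like /= => E; rewrite E in b1 b2.
  move: x1 x2; rewrite !ltr_norml => x1 x2.
  have [xa|ax|//] := ltgtP x a.
    have h1 := d1P x a; have h2 := d2P x a; rewrite !lina in h1 h2.
    move: b2; rewrite le_max !leNgt h1 ?h2 //; lra.
  have h1 := d1P a x; have h2 := d2P a x; rewrite !lina in h1 h2.
  move: b1; rewrite ge_min !leNgt h1 ?h2 //; lra.
- have [d1 d10 d1P] := dec (y - 1); have [d2 d20 d2P] := dec (y + 1).
  exists (Num.min 1 (Num.min d1 d2)) => [|x y' /=]; first by rewrite !lt_min ltr01 d10.
  rewrite !lt_min => /andP[_ /andP[x1 x2]] /andP[/(between x) /andP[b1 b2] _].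
  rewrite /linear_like /= => E; rewrite E in b1 b2.
  move: x1 x2; rewrite !ltr_norml => x1 x2.
  have [xa|ax|//] := ltgtP x a.
    have h1 := d1P x a; have h2 := d2P x a; rewrite !lina in h1 h2.
    move: b1; rewrite ge_min !leNgt h1 ?h2 //; lra.
  have h1 := d1P a x; have h2 := d2P a x; rewrite !lina in h1 h2.
  move: b2; rewrite le_max !leNgt h1 ?h2 //; lra.
Qed.

(* A trivialization near [r a] would move the vertical leaf over [a] into one of
   the two adjacent strips, hence into the same leaf as a graph leaf; moving that
   leaf back to level [r a] would connect the vertical leaf to the graph leaf. *)
Lemma zero_bifurcation (r s : R -> R) (a : R) : regular r s -> s a = 0 ->
  bifurcation_set (linear_like r s) (r a).
Proof.
move=> [cr cs fs tr] sa [U [aU [F [phi [[psi [cphi cpsi phiK psiK]] phiE]]]]].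
pose p := linear_like r s; pose c := r a.
have cp : continuous p by exact: continuous_lin.
pose A := p @^-1` U.
have UP : U c := nbhs_singleton aU.
pose mkU u (H : U u) : U := exist (fun u => u \in U) u (mem_set H).
pose mk z (H : U (p z)) : A := exist (fun z => z \in A) z (mem_set H).
pose cU := mkU c UP.
pose T (w : F) (u : U) : plane := set_val (phi (w, u)).
have pT w u : p (T w u) = set_val u by have := congr1 val (phiE (w, u)).
have cT w u : {for u, continuous (T w)}.
  apply: (@continuous_comp _ _ _ (fun u => phi (w, u)) (set_val : A -> plane)).
    apply: (@continuous_comp _ _ _ (fun u => (w, u)) phi); last exact: cphi.
    by apply: (@for_pair U F U (fun=> w) id); [exact: cst_continuous|move=> B; exact].
  exact: initial_continuous.
have nearT w (P : plane -> Prop) : (\forall z \near T w cU, P z) ->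
    \forall c' \near c, forall H : U c', P (T w (mkU c' H)).
  move=> /(cT w cU) [_ [[W oW <-]] /= Wc WP].
  apply: filterS (open_nbhs_nbhs (conj oW Wc)) => c' Wc' H.
  by apply: WP; rewrite /= set_valE.
have pa : p (a, 0) = c by rewrite /p /linear_like /lin /= sa mul0r addr0.
have UPa : U (p (a, 0)) by rewrite pa.
(* The fibre coordinate of [z], with that of [(a, 0)] as default outside the domain of the
   trivialization. *)
pose ex z : F := if pselect (U (p z)) is left H then (psi (mk z H)).1
                 else (psi (mk (a, 0) UPa)).1.
have exE w c' (H : U c') : ex (T w (mkU c' H)) = w.
  rewrite /ex; case: pselect => [H'|]; last by rewrite pT.
  rewrite (_ : mk _ H' = phi (w, mkU c' H)); first by rewrite phiK.
  exact: val_inj.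
(* Transport along the trivialization to the level [r a]; it is the identity on that level. *)
pose kappa z : plane := T (ex z) cU.
have pkappa z : p (kappa z) = c by rewrite /kappa pT.
have kappa_id z : p z = c -> kappa z = z.
  move=> pz; rewrite /kappa /ex; case: pselect => [H|]; last by rewrite pz.
  rewrite /T (_ : ((psi (mk z H)).1, cU) = psi (mk z H)) ?psiK //.
  rewrite [RHS]surjective_pairing; congr pair; apply: val_inj => /=.
  by have := congr1 val (phiE (psi (mk z H))); rewrite psiK /= => <-.
have ckappa : {within A, continuous kappa}.
  apply/subspace_sigL_continuousP.
  rewrite (_ : sigL A kappa = fun Z => T (psi Z).1 cU); last first.
    apply/funext => Z; rewrite /sigL /= /kappa /ex; case: pselect => [H|[]].
      by congr (T (psi _).1 cU); exact: val_inj.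
    exact: (set_valP Z).
  move=> Z.
  apply: (@continuous_comp _ _ _ (fun Z => phi ((psi Z).1, cU)) (set_val : A -> plane)).
    apply: (@continuous_comp _ _ _ (fun Z => ((psi Z).1, cU)) phi); last exact: cphi.
    by apply: for_pair; [exact: for_fst (cpsi Z)|exact: cst_continuous].
  exact: initial_continuous.
have ckappa_in z : interior U (p z) -> {for z, continuous kappa}.
  move=> Uz; have oA : open (p @^-1` interior U).
    by apply: (@open_comp _ _ p); [move=> ? _; exact: cp|exact: open_interior].
  have sA : p @^-1` interior U `<=` A by move=> v /interior_subset.
  have := continuous_subspaceW sA ckappa; rewrite continuous_open_subspace //.
  by apply; rewrite inE.
have [d d0 dP] := zero_isolated fs sa.
have sl : s (a - d / 2) != 0.
  by apply: dP; rewrite addrAC subrr sub0r normrN gtr0_norm; lra.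
have sr : s (a + d / 2) != 0.
  by apply: dP; rewrite addrAC subrr add0r gtr0_norm; lra.
pose zl := (a - d / 2, leaf r s c (a - d / 2)).
pose zr := (a + d / 2, leaf r s c (a + d / 2)).
have pzl : p zl = c by rewrite /p /linear_like /= lin_leaf.
have pzr : p zr = c by rewrite /p /linear_like /= lin_leaf.
have near_strip x0 z : p z = c -> strip s x0 z.1 ->
    \forall c' \near c, forall H : U c', strip s x0 (T (ex z) (mkU c' H)).1.
  move=> pz Sz; apply: (nearT (ex z) (fun w => strip s x0 w.1)).
  rewrite -/(kappa z) kappa_id //.
  exact: (@cvg_fst _ _ (nbhs z.1) (nbhs z.2) _ _ (strip_near cs Sz)).
have nl := near_strip _ zl pzl (strip_refl sl).
have nr := near_strip _ zr pzr (strip_refl sr).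
have nb : \forall c' \near c, forall H : U c', `|(T (ex (a, 0)) (mkU c' H)).1 - a| < d.
  apply: (nearT _ (fun w => `|w.1 - a| < d)); rewrite -/(kappa (a, 0)) kappa_id //.
  apply/near_planeP; exists d => //.
have nU : \forall c' \near c, interior U c'.
  by apply: open_nbhs_nbhs; split; [exact: open_interior|].
have nall : \forall c' \near c,
    ((forall H : U c', strip s zl.1 (T (ex zl) (mkU c' H)).1) /\
     (forall H : U c', strip s zr.1 (T (ex zr) (mkU c' H)).1)) /\
    ((forall H : U c', `|(T (ex (a, 0)) (mkU c' H)).1 - a| < d) /\ interior U c').
  exact: (filterI (filterI nl nr) (filterI nb nU)).
have [e e0 eP] := (near_realP _ _).1 nall.
(* At a level other than [r a] the point [b] transported from [(a, 0)] cannot lie on the line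
   [x = a]; being close to it, [b] lies in one of the two adjacent strips. *)
pose c' := c + e / 2.
have [|[Sl Sr] [Bd U'c]] := eP c'; first by rewrite /c' addrAC subrr add0r gtr0_norm; lra.
have Uc' := interior_subset U'c.
pose b := T (ex (a, 0)) (mkU c' Uc').
have pb : p b = c' by rewrite pT.
have kb : kappa b = (a, 0) by rewrite /kappa exE -/(kappa (a, 0)) kappa_id.
have main x0 z : p z = c -> z.1 != a -> strip s x0 b.1 ->
    strip s x0 (T (ex z) (mkU c' Uc')).1 -> False.
  move=> pz za Sb St; set t := T _ _ in St.
  have kt : kappa t = z by rewrite /kappa exE -/(kappa z) kappa_id.
  have linear_like' : p t = c' by rewrite pT.
  have graphE w : strip s x0 w.1 -> p w = c' -> (w.1, leaf r s c' w.1) = w.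
    move=> Sw <-; case: w Sw => x y /= Sw.
    by rewrite /p /linear_like leaf_lin //; exact: strip_neq0 Sw.
  (* Along the graph leaf of level [c'], the abscissas whose points [kappa] sends to the vertical
     leaf form a relatively open and closed set, as that leaf is isolated in its level. The set
     contains [b.1], so it would contain [t.1], but [kappa] sends [t] to [z]. *)
  have : (kappa (t.1, leaf r s c' t.1)).1 = a.
    apply: (@locally_constant_interval _ (strip s x0)
      (fun x => (kappa (x, leaf r s c' x)).1 = a) _ _ b.1 t.1) => //.
    - exact: is_interval_strip.
    - move=> x Sx; have sx := strip_neq0 Sx.
      have cg : {for x, continuous (fun x => kappa (x, leaf r s c' x))}.
        apply: (@continuous_comp _ _ _ (fun x => (x, leaf r s c' x)) kappa).
          apply: for_pair; first exact: cvg_id.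
          apply: (@for_comp2 _ _ _ _ id (fun=> c') (fun w : R * R => leaf r s w.2 w.1)).
          + exact: cvg_id.
          + exact: cvg_cst.
          + exact: continuous_leaf.
        by apply: ckappa_in; rewrite /p /linear_like /= lin_leaf.
      have pk := pkappa (x, leaf r s c' x).
      move: cg; rewrite /prop_for /continuous_at.
      case: (kappa (x, leaf r s c' x)) pk => k1 k2 pk cg.
      have [k1a|k1a] := eqVneq k1 a.
        have nv : \forall w \near (k1, k2), p w = c -> w.1 = a.
          by rewrite k1a; exact: vertical_isolated.
        have H : \forall v \near x, p (kappa (v, leaf r s c' v)) = c ->
          (kappa (v, leaf r s c' v)).1 = a := cg _ nv.
        by apply: filterS H => v Hv _; split=> // _; apply: Hv; exact: pkappa.
      have nk : \forall w \near (k1, k2), w.1 != a.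
        have : \forall v \near k1, v != a.
          apply/near_realP; exists `|k1 - a|; first by rewrite normr_gt0 subr_eq0.
          move=> v; apply: contraTneq => ->; by rewrite distrC ltxx.
        exact: (@cvg_fst _ _ (nbhs k1) (nbhs k2) _).
      have H : \forall v \near x, (kappa (v, leaf r s c' v)).1 != a := cg _ nk.
      by apply: filterS H => v /= va _; split=> E; [rewrite E eqxx in k1a|rewrite E eqxx in va].
    - by rewrite graphE // kb.
  by rewrite graphE // kt; apply/eqP.
have ba : b.1 != a.
  apply/eqP => ba; have : p b = c.
    by rewrite /p /linear_like /lin ba sa mul0r addr0.
  by rewrite pb /c'; lra.
have := Bd Uc'; rewrite -/b ltr_norml => bd.
have [b_lt|b_gt|b_eq] := ltgtP b.1 a; last by rewrite b_eq eqxx in ba.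
- apply: (main _ zl pzl _ _ (Sl Uc')); first by rewrite /= lt_eqF //; lra.
  move=> t; rewrite ge_min le_max => tP.
  have ta : t < a by move: tP; case: (leP t (a - d / 2)); case: (leP t b.1) => /=; lra.
  apply: dP; rewrite ltr0_norm ?subr_lt0 //.
  move: tP; case: (leP (a - d / 2) t); case: (leP b.1 t) => /=; lra.
- apply: (main _ zr pzr _ _ (Sr Uc')); first by rewrite /= gt_eqF //; lra.
  move=> t; rewrite ge_min le_max => tP.
  have ta : a < t by move: tP; case: (leP (a + d / 2) t); case: (leP b.1 t) => /=; lra.
  apply: dP; rewrite gtr0_norm ?subr_gt0 //.
  move: tP; case: (leP t (a + d / 2)); case: (leP t b.1) => /=; lra.
Qed.

End Bifurcation.

(** * Topological equivalence *)

Section Equivalences.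
Context {R : realType}.
Local Notation plane := (R * R)%type.

(** Extends isotopies from the unit interval to all real times, as [isotopy_orientation]
    requires. *)
Definition clip (t : R) : R := Num.max 0 (Num.min t 1).

Lemma clip_bounds t : 0 <= clip t <= 1.
Proof.
by rewrite /clip le_max lexx /= ge_max ler01 ge_min lexx orbT.
Qed.

Lemma clip0 : clip 0 = 0.
Proof. by rewrite /clip (min_idPl _) ?maxxx. Qed.

Lemma clip1 : clip 1 = 1.
Proof. by rewrite /clip minxx (max_idPr _). Qed.

Lemma continuous_clip : continuous clip.
Proof.
move=> t; apply: (@continuous_max R R (fun=> 0) (fun t => Num.min t 1) t).
  exact: cvg_cst.
by apply: continuous_min; [exact: cvg_id|exact: cvg_cst].
Qed.

Lemma orientation_preserving_sign (e : R) : e = 1 \/ e = -1 ->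
  orientation_preserving (fun z : plane => (e * z.1, e * z.2)).
Proof.
move=> eE z d d0; exists (fun=> d); case: eE => ->.
- exists id; split.
  + by move=> t; exact: cvg_cst.
  + by move=> t; exact: cvg_id.
  + by [].
  + by move=> t; rewrite /circle /= !mul1r.
  + by rewrite subr0 mulr1.
- exists (fun t => t + pi); split.
  + by move=> t; exact: cvg_cst.
  + by move=> t; apply: cvgD; [exact: cvg_id|exact: cvg_cst].
  + by [].
  + by move=> t; rewrite /circle /= cosDpi sinDpi !mulrN !mulN1r !opprD.
  + by rewrite add0r addrK mulr1.
Qed.

Lemma continuous_vertical_map (r s r' s' : R -> R) (e : R) :
  continuous r -> continuous s -> continuous r' -> continuous s' ->
  (forall x, s' x != 0) ->
  continuous (fun z : plane => (e * z.1, leaf r' s' (linear_like r s z) (e * z.1))).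
Proof.
move=> cr cs cr' cs' s'0 z.
have c1 : {for z, continuous (fun z : plane => e * z.1)}.
  by apply: cvgM; [exact: cvg_cst|exact: cvg_fst].
apply: (@for_pair _ _ _ (fun z : plane => e * z.1)
  (fun z : plane => leaf r' s' (linear_like r s z) (e * z.1))); first exact: c1.
apply: (@for_comp2 _ _ _ _ (fun z : plane => e * z.1) (linear_like r s)
  (fun w : R * R => leaf r' s' w.2 w.1)).
- exact: c1.
- exact: continuous_lin.
- exact: continuous_leaf.
Qed.

(** Without vertical leaves a point goes to the abscissa [e * x] on the same level. On vertical
    lines this map has slope [s x / s' (e * x)], so the sign condition says that both factors
    reverse or neither does; the map is then isotopic to the identity or to the half turn. *)
Lemma equivalent_signed (r s r' s' : R -> R) (e : R) :
  continuous r -> continuous s -> continuous r' -> continuous s' ->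
  e = 1 \/ e = -1 -> (forall x x', 0 < e * (s x / s' x')) ->
  o_top_equivalent (linear_like r s) (linear_like r' s').
Proof.
move=> cr cs cr' cs' eE se.
have ee x : e * (e * x) = x by case: eE => ->; rewrite ?mul1r // !mulN1r opprK.
have s0 x : s x != 0.
  by apply/eqP => s0; have := se x x; rewrite s0 mul0r mulr0 ltxx.
have s'0 x : s' x != 0.
  by apply/eqP => s0'; have := se x x; rewrite s0' invr0 !mulr0 ltxx.
pose h z := (e * z.1, leaf r' s' (linear_like r s z) (e * z.1)).
pose hi z := (e * z.1, leaf r s (linear_like r' s' z) (e * z.1)).
have ch : continuous h by exact: continuous_vertical_map.
have chi : continuous hi by exact: continuous_vertical_map.
exists h, id; split.
- split.
    exists hi; split=> //.
      by move=> [x y]; rewrite /h /hi /linear_like /= ee lin_leaf // leaf_lin.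
    by move=> [x y]; rewrite /h /hi /linear_like /= ee lin_leaf // leaf_lin.
  pose F t z := (e * z.1, (1 - clip t) * (e * z.2) + clip t * (h z).2).
  rewrite (_ : h = F 1); last first.
    by apply/funext => z; rewrite /F clip1 subrr mul0r add0r mul1r /h.
  apply: (isotopy_orientation (t0 := 0)).
  + move=> [t z].
    have c2 : {for (t, z), continuous (snd : R * plane -> plane)} by exact: cvg_snd.
    have cc : {for (t, z), continuous (fun q : R * plane => clip q.1)}.
      by apply: (@continuous_comp _ _ _ fst clip); [exact: cvg_fst|exact: continuous_clip].
    have chs : {for (t, z), continuous (fun q : R * plane => h q.2)}.
      by apply: (@continuous_comp _ _ _ snd h); [exact: cvg_snd|exact: ch].
    apply: (@for_pair _ _ _ (fun q : R * plane => e * q.2.1)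
      (fun q : R * plane => (1 - clip q.1) * (e * q.2.2) + clip q.1 * (h q.2).2)).
      by apply: cvgM; [exact: cvg_cst|exact: for_fst c2].
    apply: cvgD; apply: cvgM.
    * by apply: cvgB; [exact: cvg_cst|exact: cc].
    * by apply: cvgM; [exact: cvg_cst|exact: for_snd c2].
    * exact: cc.
    * exact: for_snd chs.
  + move=> t [x y] [x' y']; rewrite /F /h /= => -[/(congr1 (fun v => e * v))].
    rewrite !ee => <- E; congr pair.
    have /andP[t0 t1] := clip_bounds t.
    (* Up to the factor [e], the slope of [F t] on a vertical line: a convex combination of 1 and a
       positive number. *)
    have k0 : 0 < (1 - clip t) + clip t * (e * (s x / s' (e * x))).
      have k1 := se x (e * x).
      have k2 : 0 <= clip t * (e * (s x / s' (e * x))).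
        by rewrite mulr_ge0 // ltW.
      have [tt|tt] := ltP (clip t) 1; first lra.
      have -> : clip t = 1 by lra.
      lra.
    have : ((1 - clip t) + clip t * (e * (s x / s' (e * x)))) * (y - y') = 0.
      transitivity (e * ((1 - clip t) * (e * y) +
        clip t * leaf r' s' (linear_like r s (x, y)) (e * x)) -
        e * ((1 - clip t) * (e * y') +
        clip t * leaf r' s' (linear_like r s (x, y')) (e * x))).
        rewrite /linear_like /leaf /lin /=.
        transitivity ((1 - clip t) * ((e * (e * y)) - (e * (e * y'))) +
           clip t * (e * (s x / s' (e * x))) * (y - y')).
          by rewrite !ee; ring.
        by field; exact: s'0.
      by rewrite E subrr.
    by move=> /eqP; rewrite mulf_eq0 gt_eqF //= subr_eq0 => /eqP.
  + rewrite (_ : F 0 = fun z : plane => (e * z.1, e * z.2)).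
      exact: orientation_preserving_sign.
    by apply/funext => z; rewrite /F clip0 subr0 mul1r mul0r addr0.
- split=> //; exists id; split=> // x; exact: cvg_id.
- by apply/funext => z; rewrite /h /= /linear_like /= lin_leaf.
Qed.

Lemma nonvanishing_sign (s : R -> R) : continuous s -> (forall x, s x != 0) ->
  (forall x, 0 < s x) \/ (forall x, s x < 0).
Proof.
move=> cs s0.
have key (f : R -> R) : continuous f -> (forall x, f x != 0) -> 0 < f 0 ->
    forall x, 0 < f x.
  move=> cf f0 fp x; have [x0|x0] := leP x 0.
    by apply: (sign_constant cf x0) => // t _; exact: f0.
  rewrite ltNge le_eqVlt (negbTE (f0 x)) /=; apply/negP => fx.
  suff : 0 < - f 0 by rewrite oppr_gt0 ltNge (ltW fp).
  apply: (@sign_constant _ (fun t => - f t) 0 x _ (ltW x0)).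
  - by move=> t; apply: cvgN; exact: cf.
  - by move=> t _; rewrite oppr_eq0.
  - by rewrite oppr_gt0.
have [s00|s00|s00] := ltgtP (s 0) 0; last by have := s0 0; rewrite s00 eqxx.
  right=> x; rewrite -oppr_gt0; apply: (key (fun t => - s t)).
  - by move=> t; apply: cvgN; exact: cs.
  - by move=> t; rewrite oppr_eq0.
  - by rewrite oppr_gt0.
by left; exact: key.
Qed.

Lemma equivalent_no_zero (r s r' s' : R -> R) :
  continuous r -> continuous s -> continuous r' -> continuous s' ->
  (forall x, s x != 0) -> (forall x, s' x != 0) ->
  o_top_equivalent (linear_like r s) (linear_like r' s').
Proof.
move=> cr cs cr' cs' s0 s'0.
have [sp|sn] := nonvanishing_sign cs s0;
have [sp'|sn'] := nonvanishing_sign cs' s'0.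
- apply: (@equivalent_signed _ _ _ _ 1) => //; first by left.
  by move=> x x'; rewrite mul1r divr_gt0.
- apply: (@equivalent_signed _ _ _ _ (-1)) => //; first by right.
  by move=> x x'; rewrite mulN1r oppr_gt0 pmulr_rlt0 // invr_lt0.
- apply: (@equivalent_signed _ _ _ _ (-1)) => //; first by right.
  by move=> x x'; rewrite mulN1r oppr_gt0 pmulr_llt0 // invr_gt0.
- apply: (@equivalent_signed _ _ _ _ 1) => //; first by left.
  by move=> x x'; rewrite mul1r nmulr_rgt0 // invr_lt0.
Qed.

Lemma increasing_inverse (f g : R -> R) : {homo f : x y / x < y} ->
  cancel g f -> {homo g : x y / x < y} /\ continuous g.
Proof.
move=> inc gK.
have mono x y : f x < f y -> x < y.
  by have [//|/inc h1 h2|->] := ltgtP x y; [have := lt_trans h1 h2|]; rewrite ltxx.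
have ginc : {homo g : x y / x < y} by move=> x y xy; apply: mono; rewrite !gK.
split=> // v; apply/cvgrPdist_lt => e e0.
have h1 : f (g v - e) < v by rewrite -[ltRHS]gK; apply: inc; lra.
have h2 : v < f (g v + e) by rewrite -[ltLHS]gK; apply: inc; lra.
have n1 := lt_nbhsr h1; have n2 := lt_nbhsl h2.
near=> w.
have w1 : f (g v - e) < w by near: w; exact: n1.
have w2 : w < f (g v + e) by near: w; exact: n2.
have := mono (g v - e) (g w); rewrite gK => /(_ w1) l1.
have := mono (g w) (g v + e); rewrite gK => /(_ w2) l2.
by rewrite ltr_norml; lra.
Unshelve. all: by end_near. Qed.

(** * Making the level maps of all strips coincide *)

Section Straightening.
Variables (r s r' s' : R -> R) (h : plane -> plane).
Hypotheses (reg : regular r s) (reg' : regular r' s').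
Let p := linear_like r s.
Let q := linear_like r' s'.
Hypothesis hh : o_equivalence_homeo (level_foliation p) (level_foliation q) h.
Variables (c1 c2 : R).
Let lam := level_map r s q h.
Hypothesis c12 : c1 < c2.
Hypothesis lam_order : forall m, s m != 0 -> lam m c1 < lam m c2.
Variable sigma : R -> R.
Hypothesis sigmaP : forall z, (exists2 a, s a = 0 & p z = r a) ->
  q (h z) = sigma (p z).

Lemma equivalent_straightening : o_top_equivalent p q.
Proof.
have [[hom hor] hL] := hh; have [hi [ch chi hK hiK]] := hom.
have [cr cs fs tr] := reg; have [cr' cs' fs' tr'] := reg'.
have hl := leafwise_equivalence hL.
have hil := leafwise_inverse hK hiK hL.
have cq : continuous q by exact: continuous_lin.
have cp : continuous p by exact: continuous_lin.
have lam_inc m : s m != 0 -> {homo lam m : x y / x < y}.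
  by move=> sm; apply: (level_map_increasing reg reg' ch chi hK hiK hl sm c12);
    exact: lam_order.
have lam_cont m : s m != 0 -> continuous (lam m) by move=> sm; exact: continuous_level_map.
have [inv invP] : exists inv : R -> R -> R,
    forall m, s m != 0 -> cancel (inv m) (lam m).
  have E (mv : R * R) : exists c, s mv.1 != 0 -> lam mv.1 c = mv.2.
    have [sm|sm] := boolP (s mv.1 == 0); first by exists 0.
    have [c cP] := level_map_surjective reg reg' ch chi hK hil mv.2 sm (lam_inc _ sm).
    by exists c.
  have [f fP] := choice E.
  by exists (fun m v => f (m, v)) => m sm v; exact: (fP (m, v) sm).
have lamK m : s m != 0 -> cancel (lam m) (inv m).
  move=> sm c; have E := invP m sm (lam m c).
  by have [/(lam_inc m sm)|/(lam_inc m sm)|//] := ltgtP (inv m (lam m c)) c; rewrite E ltxx.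
have inv_inc m : s m != 0 -> {homo inv m : x y / x < y}.
  by move=> sm; exact: (increasing_inverse (lam_inc m sm) (invP m sm)).1.
have inv_cont m : s m != 0 -> continuous (inv m).
  by move=> sm; exact: (increasing_inverse (lam_inc m sm) (invP m sm)).2.
have lam_zero m a : s m != 0 -> s a = 0 -> lam m (r a) = sigma (r a).
  move=> sm sa; rewrite /lam /level_map.
  have E : p (m, leaf r s (r a) m) = r a by rewrite /p /linear_like /= lin_leaf.
  by rewrite sigmaP E //; exists a.
have [m0 sm0] : exists m0, s m0 != 0.
  have [s00|s00] := eqVneq (s 0) 0; last by exists 0.
  have [d d0 dP] := zero_isolated fs s00; exists (d / 2); apply: dP.
  by rewrite subr0 gtr0_norm; lra.
pose l := lam m0.
(* This is [mu_m], completed by the identity where [s m = 0] so that monotonicity and continuity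
   hold for every [m]; [N'] is its inverse. *)
pose N m c := if s m == 0 then c else inv m (l c).
pose N' m c := if s m == 0 then c else inv m0 (lam m c).
have N_inc m : {homo N m : x y / x < y}.
  move=> x y xy; rewrite /N; case: ifPn => // sm.
  by apply: inv_inc => //; exact: lam_inc.
have N'_inc m : {homo N' m : x y / x < y}.
  move=> x y xy; rewrite /N'; case: ifPn => // sm.
  by apply: inv_inc => //; exact: lam_inc.
(* All level maps take the value [sigma (r a)] at [r a], so passing from one strip to another fixes
   [r a]. *)
have N_zero m a : s a = 0 -> N m (r a) = r a.
  move=> sa; rewrite /N; case: ifPn => // sm.
  by rewrite /l lam_zero // -(lam_zero m) // lamK.
have N'_zero m a : s a = 0 -> N' m (r a) = r a.
  move=> sa; rewrite /N'; case: ifPn => // sm.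
  by rewrite lam_zero // -(lam_zero m0) // lamK.
have N_cont m : continuous (N m).
  have [sm|sm] := boolP (s m == 0).
    have -> : N m = id by apply/funext => x; rewrite /N sm.
    by move=> c; exact: cvg_id.
  have -> : N m = inv m \o l by apply/funext => x; rewrite /N (negbTE sm).
  by move=> c; apply: continuous_comp; [exact: lam_cont|exact: inv_cont].
have N'_cont m : continuous (N' m).
  have [sm|sm] := boolP (s m == 0).
    have -> : N' m = id by apply/funext => x; rewrite /N' sm.
    by move=> c; exact: cvg_id.
  have -> : N' m = inv m0 \o lam m by apply/funext => x; rewrite /N' (negbTE sm).
  by move=> c; apply: continuous_comp; [exact: lam_cont|exact: inv_cont].
have sides (f : R -> R) : {homo f : x y / x < y} ->
    (forall a, s a = 0 -> f (r a) = r a) -> forall c, same_side r s c (f c).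
  move=> finc fz c b sb; rewrite -{2 4}(fz b sb).
  have le x y : (f x < f y) = (x < y).
    by apply/idP/idP; [|exact: finc]; have [//|/finc h1 h2|->] := ltgtP x y;
      [have := lt_trans h1 h2|]; rewrite ltxx.
  by rewrite !le.
have NP : preserves_sides r s N by move=> m c; apply: sides => //; exact: N_zero.
have NP' : preserves_sides r s N' by move=> m c; apply: sides => //; exact: N'_zero.
have coord_exists m : exists k, s m != 0 -> strip_coord r s m k.
  have [sm|sm] := boolP (s m == 0); first by exists (fun _ _ => 0).
  by have [k kP] := strip_coord_exists cr cs tr sm; exists k.
have [K KP] := choice coord_exists.
(* The straight isotopy from the identity to [N]. Every stage is increasing and fixes each [r a], as
   both ends do, so it defines a leaf shift. *)
pose M t m c := (1 - clip t) * c + clip t * N m c.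
have M_inc t m : {homo M t m : x y / x < y}.
  move=> x y xy; have /andP[t0 t1] := clip_bounds t.
  have Nxy := N_inc m _ _ xy; rewrite /M.
  have h1 : (1 - clip t) * x <= (1 - clip t) * y 
    by apply: ler_wpM2l; [rewrite subr_ge0|exact: ltW].
  have h2 : clip t * N m x <= clip t * N m y by apply: ler_wpM2l => //; exact: ltW.
  have [tp|tp] := ltP 0 (clip t).
    have : clip t * N m x < clip t * N m y by rewrite ltr_pM2l.
    lra.
  have -> : clip t = 0 by lra.
  lra.
have M_zero t m a : s a = 0 -> M t m (r a) = r a.
  by move=> sa; rewrite /M N_zero // -mulrDl subrK mul1r.
have MP t : preserves_sides r s (M t).
  by move=> m c; apply: sides; [exact: M_inc|exact: M_zero].
have M_cont m : continuous (fun tc : R * R => M tc.1 m tc.2).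
  move=> [t c].
  have cc : {for (t, c), continuous (fun q : R * R => clip q.1)}.
    by apply: (@continuous_comp _ _ _ fst clip); [exact: cvg_fst|exact: continuous_clip].
  apply: cvgD; apply: cvgM.
  - by apply: cvgB; [exact: cvg_cst|exact: cc].
  - exact: cvg_snd.
  - exact: cc.
  - by apply: (@continuous_comp _ _ _ snd (N m)); [exact: cvg_snd|exact: N_cont].
have M0 : M 0 = fun _ c => c.
  by apply/funext => m; apply/funext => c; rewrite /M clip0 subr0 mul1r mul0r addr0.
have M1 : M 1 = N.
  by apply/funext => m; apply/funext => c; rewrite /M clip1 subrr mul0r add0r mul1r.

have cG := continuous_leaf_shift (KP := KP) cr cs fs MP M_cont.
have shift_cont (N0 : R -> R -> R) : preserves_sides r s N0 ->
    (forall m, continuous (N0 m)) -> continuous (leaf_shift KP N0).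
  move=> NP0 cN0 z.
  have cN1 m : continuous (fun tc : R * R => (fun (_ : R) => N0) tc.1 m tc.2).
    move=> tc; apply: (@continuous_comp _ _ _ snd (N0 m)); first exact: cvg_snd.
    exact: cN0.
  have c0 := continuous_leaf_shift (KP := KP) cr cs fs (fun=> NP0) cN1.
  apply: (@for_comp2 _ _ _ _ (fun=> 0) id
    (fun w : R * plane => leaf_shift KP N0 w.2)).
  - exact: cvg_cst.
  - exact: cvg_id.
  - exact: c0.
have NK m : cancel (N m) (N' m).
  move=> c; rewrite /N /N'; have [//|sm] := boolP (s m == 0).
  by rewrite invP // lamK.
have N'K m : cancel (N' m) (N m).
  move=> c; rewrite /N /N'; have [//|sm] := boolP (s m == 0).
  by rewrite /l invP // lamK.
exists (h \o leaf_shift KP N), l; split.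
- split.
    exists (leaf_shift KP N' \o hi); split.
    + move=> z; apply: continuous_comp; last exact: ch.
      exact: shift_cont.
    + move=> z; apply: continuous_comp; first exact: chi.
      exact: shift_cont.
    + move=> z /=; rewrite hK.
      exact: (leaf_shift_cancel KP NP NP' NK).
    + move=> z /=; rewrite (leaf_shift_cancel KP NP' NP N'K).
      exact: hiK.
  rewrite -M1; apply: (@isotopy_orientation _ (fun t => h \o leaf_shift KP (M t)) 0 1).
  + move=> q0; apply: (@continuous_comp _ _ _
      (fun q0 : R * plane => leaf_shift KP (M q0.1) q0.2) h); [exact: cG|exact: ch].
  + move=> t; apply: inj_comp; first exact: can_inj hK.
    apply: (leaf_shift_inj (KP := KP) (MP t)) => m x y xy.
    by have [/(M_inc t m)|/(M_inc t m)|//] := ltgtP x y; rewrite xy ltxx.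
  + rewrite (_ : h \o _ = h) //; apply/funext => z /=.
    by rewrite (leaf_shift_id KP (MP 0)) // M0.
- split; last exact: lam_inc.
  exists (inv m0); split; [exact: lam_cont|exact: inv_cont|exact: lamK|exact: invP].
- apply/funext => z /=.
  have [/eqP sz|sz] := boolP (s z.1 == 0).
    rewrite leaf_shift_vertical //.
    have pz : p z = r z.1 by rewrite /p /linear_like /lin sz mul0r addr0.
    by rewrite sigmaP; [rewrite pz /l lam_zero|exists z.1].
  have [S1 _] := leaf_shift_match KP NP sz.
  rewrite (level_mapE cr cs hl S1) -/q -/lam linear_like_leaf_shift // /N.
  by rewrite (negbTE (base_neq0 sz)) invP // base_neq0.
Qed.

End Straightening.

Lemma level_foliation_conj (f g : plane -> R) (h : plane -> plane) (l : R -> R) :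
  homeomorphism h -> injective l -> l \o f = g \o h ->
  forall L, level_foliation f L -> level_foliation g (h @` L).
Proof.
move=> [hi [ch chi hK hiK]] linj lf _ [z ->].
have lfz w : l (f w) = g (h w) by have := congr1 (fun k => k w) lf.
exists (h z); apply/seteqP; split.
  apply: connected_component_max.
  - by exists z => //; exact: connected_component_refl.
  - by move=> _ [w /connected_component_sub /= fw <-] /=; rewrite -!lfz fw.
  - apply: connected_continuous_connected; first exact: component_connected.
    exact: continuous_subspaceT.
move=> w Cw; exists (hi w); last exact: hiK.
have : (hi @` connected_component (g @^-1` [set g (h z)]) (h z)) (hi w) by exists w.
apply: connected_component_max.
- by exists (h z); [exact: connected_component_refl|exact: hK].
- move=> _ [v /connected_component_sub /= gv <-] /=; apply: linj.
  by rewrite !lfz hiK.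
- apply: connected_continuous_connected; first exact: component_connected.
  exact: continuous_subspaceT.
Qed.

End Equivalences.

Theorem theorem1p1 (R : realType) (p q : R * R -> R)
    (hp : finite_linear_like_submersion p)
    (hq : finite_linear_like_submersion q) :
  o_top_equivalent p q <->
  (bifurcation_set p = set0 /\ bifurcation_set q = set0) \/
  (foliation_o_equivalent (level_foliation p) (level_foliation q) /\
   exists (h : R * R -> R * R) (sigma : R -> R),
     [/\ o_equivalence_homeo (level_foliation p) (level_foliation q) h,
         increasing_bij (bifurcation_set p) (bifurcation_set q) sigma,
         forall b c, bifurcation_set p b -> bifurcation_set q c ->
           sigma b = c -> p @^-1` [set b] = h @^-1` (q @^-1` [set c])
       & (exists b, bifurcation_set p = [set b]) ->
         exists (m : R) (sigmabar : R -> R),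
           [/\ ~ bifurcation_set p m,
               forall b, bifurcation_set p b -> sigmabar b = sigma b,
               increasing_bij (bifurcation_set p `|` [set m])
                 (bifurcation_set q `|` [set sigmabar m]) sigmabar
             & p @^-1` [set m] = h @^-1` (q @^-1` [set sigmabar m])]]).
Proof.
split=> [[h [l [[hom hor] [lhom linc] lE]]]|].
  have linj : injective l by case: lhom => li [_ _ lK _]; exact: can_inj lK.
  have lEz z : l (p z) = q (h z) by have := congr1 (fun k => k z) lE.
  have heq : o_equivalence_homeo (level_foliation p) (level_foliation q) h.
    by split; [split|exact: level_foliation_conj hom linj lE].
  have Bl y : bifurcation_set q (l y) <-> bifurcation_set p y.
    by apply: bifurcation_conj hom lhom lEz.
  have fib b : p @^-1` [set b] = h @^-1` (q @^-1` [set l b]).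
    apply/seteqP; split=> z /= => [<-|]; first by rewrite lEz.
    by rewrite -lEz => /linj.
  have Bsurj : set_surj (bifurcation_set p) (bifurcation_set q) l.
    case: lhom => li [_ _ _ liK] y; rewrite -(liK y) => /Bl By.
    by exists (li y).
  right; split; first by exists h.
  exists h, l; split=> //.
  - split; last by move=> x y _ _; exact: linc.
    split; [by move=> y /Bl|by move=> x y _ _; exact: linj|exact: Bsurj].
  - by move=> b c _ _ <-.
  (* Any level other than [b] would do, since [l] respects all levels. *)
  - move=> [b Bb]; exists (b + 1), l; split=> //.
    + by rewrite Bb /= => /eqP; rewrite -subr_eq0 addrAC subrr add0r oner_eq0.
    + split; last by move=> x y _ _; exact: linc.
      split.
      * by move=> y [/Bl|->]; [left|right].
      * by move=> x y _ _; exact: linj.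
      * by move=> y [/Bsurj[x Bx <-]|->]; [exists x => //; left|exists (b + 1) => //; right].
have [r [s [reg pE]]] := linear_like_regular hp.
have [r' [s' [reg' qE]]] := linear_like_regular hq.
(* A zero [a] of [s] would make [r a] a bifurcation value, so neither function has a vertical leaf
   here. *)
have noB : bifurcation_set p = set0 -> bifurcation_set q = set0 ->
    o_top_equivalent p q.
  move=> Bp Bq; have [cr cs _ _] := reg; have [cr' cs' _ _] := reg'.
  rewrite pE qE; apply: equivalent_no_zero => // x; apply/eqP => sx.
    by have := zero_bifurcation reg sx; rewrite -pE Bp.
  by have := zero_bifurcation reg' sx; rewrite -qE Bq.
case=> [[]//|[_ [h [sigma [heq [[sfun sinj ssurj] sinc] fib single]]]]].
have [Bp0|/set0P[b0 Bb0]] := eqVneq (bifurcation_set p) set0.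
  apply: noB => //; apply/seteqP; split=> // y /ssurj[x].
  by rewrite Bp0.
have fibB z : bifurcation_set p (p z) -> q (h z) = sigma (p z).
  move=> Bz; have := fib (p z) (sigma (p z)) Bz (sfun _ Bz) erefl.
  by move=> /seteqP[/(_ z erefl)].
(* Two levels whose images are in the right order fix the direction of every [lam_m]: two
   bifurcation values if there are that many, otherwise the single one and the level [m]. *)
have [c1 [c2 [c12 order]]] : exists c1 c2, c1 < c2 /\
    forall z1 z2, p z1 = c1 -> p z2 = c2 -> q (h z1) < q (h z2).
  have [[b1 [Bb1 b10]]|nob] := pselect (exists b1, bifurcation_set p b1 /\ b1 != b0).
    have [b01|b01|b01] := ltgtP b1 b0; last by rewrite b01 eqxx in b10.
    - exists b1, b0; split=> // z1 z2 z1E z2E.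
      by rewrite !fibB ?z1E ?z2E //; exact: sinc.
    - exists b0, b1; split=> // z1 z2 z1E z2E.
      by rewrite !fibB ?z1E ?z2E //; exact: sinc.
  have Bset : bifurcation_set p = [set b0].
    apply/seteqP; split=> [y By|_ ->//]; apply: contrapT => /eqP yb.
    by apply: nob; exists y.
  have [m [sb [nBm sbE [_ sbinc] fibm]]] := single (ex_intro _ b0 Bset).
  have qm z : p z = m -> q (h z) = sb m by move: fibm => /seteqP[+ _] zm => /(_ z zm).
  have qb z : p z = b0 -> q (h z) = sb b0 by move=> zb; rewrite sbE // -zb fibB // zb.
  have [mb|bm|mb] := ltgtP m b0; last by rewrite mb in nBm.
  - exists m, b0; split=> // z1 z2 /qm -> /qb ->.
    by apply: sbinc => //; [right|left].
  - exists b0, m; split=> // z1 z2 /qb -> /qm ->.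
    by apply: sbinc => //; [left|right].
rewrite pE qE in heq *.
apply: (@equivalent_straightening R r s r' s' h reg reg' heq c1 c2 c12 _ sigma).
- move=> m sm; rewrite /level_map -qE; apply: order; rewrite pE /linear_like /= lin_leaf //.
- move=> z [a sa za]; rewrite -pE -qE; apply: fibB.
  by rewrite {2}pE za pE; exact: zero_bifurcation.
Qed.
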